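(* Let $K \subset \mathbb{R}$ be an equicontractive self-similar set with $\dim_{\mathrm{H}} K > 1/3$. Then the set $$(\cos \theta) \cdot K + (\sin \theta) \cdot K + K$$ has positive length (positive one-dimensional Lebesgue measure) for Lebesgue almost all $\theta \in [0,1]$.
   Context: $\dim_{\mathrm{H}}$ denotes Hausdorff dimension. A self-similar set $K\subset\mathbb{R}$ is the unique nonempty compact set satisfying $K = \bigcup_{i=1}^q \psi_i(K)$ for a finite collection of contracting similitudes $\psi_1,\dots,\psi_q$ of $\mathbb{R}$. It is called equicontractive if all the generating similitudes have equal contraction ratios. For sets $A, B \subset \mathbb{R}$ and $t\in\mathbb{R}$, $t\cdot A = \{ta : a \in A\}$ and $A + B = \{a+b : a\in A, b\in B\}$. *)

(* Defs.v *)
From mathcomp Require Import all_boot all_order all_algebra.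
From mathcomp Require Import all_classical all_reals all_analysis.

Set Implicit Arguments.
Unset Strict Implicit.
Unset Printing Implicit Defensive.

Import Order.TTheory GRing.Theory Num.Theory.
Import numFieldNormedType.Exports.

Local Open Scope classical_set_scope.
Local Open Scope ring_scope.

Section HausdorffDimension.
Context {R : realType}.
Local Open Scope ereal_scope.

(* The maximum with 0 only affects the empty set, whose supremum is -oo. *)
Definition diam (U : set R) : \bar R :=
  maxe 0 (ereal_sup [set `|x - y|%:E | x in U & y in U]).

(* The empty set is singled out because 0 `^ 0 = 1: it must contribute
   nothing, also when s = 0. *)
Definition diam_pow (s : R) (U : set R) : \bar R :=
  if U == set0 then 0 else diam U `^ s.

Definition delta_cover (delta : R) (A : set R) (U : nat -> set R) : Prop :=
  A `<=` \bigcup_i U i /\ forall i, diam (U i) <= delta%:E.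

Definition hausdorff_premeasure (s delta : R) (A : set R) : \bar R :=
  ereal_inf [set \sum_(0 <= i <oo) diam_pow s (U i) | U in delta_cover delta A].

Definition hausdorff_measure (s : R) (A : set R) : \bar R :=
  ereal_sup [set hausdorff_premeasure s delta A |
             delta in [set delta : R | (0 < delta)%R]].

Definition hausdorff_dim (A : set R) : \bar R :=
  ereal_inf [set s%:E |
             s in [set s : R | (0 <= s)%R /\ hausdorff_measure s A = 0]].

End HausdorffDimension.

Section SelfSimilarSets.
Context {R : realType}.

Definition contracting_similitude (r : R) (f : R -> R) : Prop :=
  0 < r < 1 /\ forall x y, `|f x - f y| = r * `|x - y|.

(* K is the attractor of the maps psi i: for contractions and 0 < q, there is
   exactly one nonempty compact set with this property. *)
Definition is_attractor (q : nat) (psi : 'I_q -> R -> R) (K : set R) : Prop :=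
  [/\ K !=set0, compact K & K = \bigcup_(i in [set: 'I_q]) (psi i @` K)].

(* The common ratio r is the metric one, so orientation-preserving and
   orientation-reversing maps may both occur among the psi i. *)
Definition equicontractive_self_similar (K : set R) : Prop :=
  exists (q : nat) (psi : 'I_q -> R -> R) (r : R),
    (forall i, contracting_similitude r (psi i)) /\ is_attractor psi K.

Definition scale_set (t : R) (A : set R) : set R := [set t * a | a in A].

Definition add_set (A B : set R) : set R := [set a + b | a in A & b in B].

End SelfSimilarSets.

(* Main.v *)
(** Write [g theta (a, b) = b cos theta - a sin theta], the derivative of
    [a cos theta + b sin theta + c].  Sublevel sets of the latter are large only
    for differences [(a, b, c)] of points of K^3 at which both the function and
    [g] are small, that is, for [(a, b)] nearly parallel to
    [(cos theta, sin theta)].  So one first gets rid of these differences.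

    By [dim K > 1/3], K contains a homogeneous self-similar set without
    reflections, with M strongly separated pieces of ratio rho, where
    [M^3 rho > 1]; dropping pieces, one may also assume [M^2 rho < 1].  Then the
    projections [g theta] of K x K lose no dimension for almost every theta0: the
    expected number of pairs of level-n words whose [g theta0]-projections are
    rho^n-close is comparable to the number of words.  By a Turan argument there
    is, for some n, a set W of level-n words of K x K with separated projections
    and with [#|W| M^n rho^n > 1].  The self-similar set generated by W in the
    plane and by all level-n words on the third axis is transversal for theta near
    theta0, and its similarity dimension exceeds 1.  The same energy recursion
    now bounds the number of close pairs among its projections by
    [const * #pairs * scale], so that for almost every theta near theta0 the
    projection contains, at infinitely many scales delta, about 1/delta points
    that are delta-separated; a null compact set does not.  *)

Require Import Defs.
From mathcomp Require Import all_boot all_order all_algebra.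
From mathcomp Require Import all_classical all_reals all_analysis.
From mathcomp Require Import measurable_realfun.
From mathcomp Require Import ring lra zify.

Set Implicit Arguments.
Unset Strict Implicit.
Unset Printing Implicit Defensive.

Import Order.TTheory GRing.Theory Num.Theory.
Import numFieldNormedType.Exports.
Local Open Scope classical_set_scope.
Local Open Scope ring_scope.

(** * Independent sets and words *)

(** Greedy selection: an element joins the set only if it is related to no member chosen so far, so
    every rejected element is dominated. The last clause is maximality. *)
Lemma maximal_independent (T : eqType) (r : rel T) (s : seq T) :
  reflexive r -> symmetric r ->
  exists W : seq T, [/\ {subset W <= s}, uniq W,
    {in W &, forall u v, u != v -> ~~ r u v} &
    {in s, forall v, has (r v) W}].
Proof.
move=> rr rs; elim: s => [|x s [W [Ws uW iW dW]]]; first by exists [::].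
have [hx|hx] := boolP (has (r x) W).
  exists W; split=> //; first by move=> w /Ws; rewrite inE orbC => ->.
  by move=> v; rewrite inE => /orP[/eqP->//|/dW].
exists (x :: W); split.
- by move=> w; rewrite !inE => /orP[->//|/Ws->]; rewrite orbT.
- rewrite /= uW andbT; apply: contra hx => xW.
  by apply/hasP; exists x.
- move=> u v; rewrite !inE => /orP[/eqP->|uI] /orP[/eqP->|vI].
  + by rewrite eqxx.
  + by move=> _; apply: contra hx => rxv; apply/hasP; exists v.
  + by move=> _; apply: contra hx => rxv; apply/hasP; exists u; rewrite // rs.
  + exact: iW.
- move=> v; rewrite inE => /orP[/eqP->|/dW] /=; first by rewrite rr.
  by move=> ->; rewrite orbT.
Qed.

(* Vertices of degree at most twice the average make up half of [s]; a maximal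
   independent subset of those dominates them. *)
Lemma weak_turan (T : eqType) (r : rel T) (s : seq T) :
  reflexive r -> symmetric r ->
  exists W : seq T, [/\ {subset W <= s}, uniq W,
    {in W &, forall u v, u != v -> ~~ r u v} &
    (size s ^ 2 <= 4 * size W * \sum_(u <- s) count (r u) s)%N].
Proof.
move=> rr rs; have [E EE] : exists E, E = (\sum_(u <- s) count (r u) s)%N by eexists.
rewrite -EE.
pose low u := (size s * count (r u) s <= 2 * E)%N.
have [W [Wl uW iW dW]] := maximal_independent [seq u <- s | low u] rr rs.
exists W; split=> //.
  by move=> w /Wl; rewrite mem_filter => /andP[].
have [s0|s0] := posnP (size s); first by rewrite s0.
have Egt0 : (0 < E)%N.
  rewrite EE; case: (s) s0 => // x t _; rewrite big_cons /= rr.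
  by lia.
(* Markov's inequality for the degree: at most half of the vertices exceed twice the average. *)
have high : (count (predC low) s * (2 * E) <= size s * E)%N.
  rewrite [in leqRHS]EE big_distrr /= -sum1_count big_distrl /=.
  rewrite [leqRHS](bigID low) /= -[leqLHS]add0n leq_add//.
  by apply: leq_sum => u; rewrite mul1n /low -ltnNge => /ltnW.
have half : (size s <= 2 * count low s)%N.
  have := count_predC low s; have : (count (predC low) s * 2 <= size s)%N.
    by rewrite -(leq_pmul2r Egt0) -mulnA.
  lia.
have cov : (size s * count low s <= size W * (2 * E))%N.
  have : (count low s <= \sum_(w <- W) count (r w) s)%N.
    have -> : count low s = (\sum_(v <- s | low v) 1)%N by rewrite sum1_count.
    have -> : (\sum_(w <- W) count (r w) s =
               \sum_(v <- s) \sum_(w <- W) r w v)%N.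
      rewrite exchange_big /=; apply: eq_bigr => w _.
      by rewrite -sum1_count big_mkcond.
    rewrite big_mkcond /= big_seq [leqRHS]big_seq; apply: leq_sum => v vs.
    case: ifP => // lv.
    have /dW /hasP[w wW rvw] : v \in [seq u <- s | low u] by rewrite mem_filter lv.
    by rewrite (bigD1_seq w)//= rs rvw; lia.
  rewrite -(leq_pmul2l s0) => /leq_trans; apply.
  rewrite big_distrr /= -[size W]sum1_size big_distrl /= big_seq [leqRHS]big_seq.
  apply: leq_sum => w /Wl; rewrite mem_filter => /andP[lw _].
  by rewrite mul1n.
have : (size s * size s <= 2 * (size W * (2 * E)))%N.
  by apply: leq_trans (leq_mul (leqnn 2) cov); rewrite mulnCA leq_mul2l half orbT.
by rewrite -mulnn; lia.
Qed.

Fixpoint words (T : Type) (I : seq T) (k : nat) : seq (seq T) :=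
  if k is k'.+1 then [seq i :: w | i <- I, w <- words I k'] else [:: [::]].

Lemma size_words (T : Type) (I : seq T) k : size (words I k) = (size I ^ k)%N.
Proof. by elim: k => // k IH; rewrite /= size_allpairs IH expnS. Qed.

Lemma words_uniq (T : eqType) (I : seq T) k : uniq I -> uniq (words I k).
Proof.
move=> uI; elim: k => //= k IH; rewrite allpairs_uniq//.
by move=> [i u] [j v] /= _ _ [-> ->].
Qed.

Lemma mem_words (T : eqType) (I : seq T) k w :
  (w \in words I k) = (size w == k) && all (mem I) w.
Proof.
elim: k w => [|k IH] [|i w] //=.
- by apply/negbTE/negP => /allpairsPdep[? [? []]].
- apply/allpairsPdep/idP => [[j [v [jI]]]|].
    by rewrite IH => /andP[/eqP <- av] [-> ->]; rewrite eqxx jI.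
  by rewrite eqSS => /and3P[sw iI aw]; exists i, w; rewrite IH sw.
Qed.

(** * Trigonometric estimates *)

Section Trigonometry.
Context {R : realType}.
Implicit Types a b c x y u : R.

Let sin_mvt u : 0 <= u -> exists2 c, 0 <= c <= u & sin u = cos c * u.
Proof.
move=> u0; have [|c] := @MVT_segment R sin cos 0 u u0.
- by apply: continuous_subspaceT => x; exact: continuous_sin.
- by rewrite in_itv /= sin0 !subr0 => ? ?; exists c.
Qed.

Lemma norm_sin_le u : `|sin u| <= `|u|.
Proof.
wlog u0 : u / 0 <= u.
  move=> H; have [/H//|/ltW u0] := leP 0 u.
  by rewrite -normrN -sinN -[leRHS]normrN H// oppr_ge0.
have [c _ ->] := sin_mvt u0.
by rewrite normrM ler_piMl// cos_max.
Qed.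

(** By the mean value theorem [sin u = cos c * u] with [c] in [[0, 1]], and [cos c = 1 - 2 sin^2 (c
    / 2) >= 1 - c^2 / 2 >= 1 / 2]. *)
Lemma norm_sin_ge u : `|u| <= 1 -> `|u| / 2 <= `|sin u|.
Proof.
wlog u0 : u / 0 <= u.
  move=> H; have [/H//|/ltW u0] := leP 0 u.
  by have := H (- u); rewrite sinN !normrN oppr_ge0; exact.
rewrite ger0_norm// => u1; have [c /andP[c0 cu] ->] := sin_mvt u0.
suff ch : 1 / 2 <= cos c.
  by rewrite ger0_norm ?mulr_ge0//; nra.
have -> : cos c = 1 - 2 * sin (c / 2) ^+ 2.
  rewrite [in LHS](_ : c = (c / 2) *+ 2); last by rewrite -mulr_natr divfK.
  by rewrite cos_mulr2n cos2sin2 -mulr_natl; ring.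
have : sin (c / 2) ^+ 2 <= (c / 2) ^+ 2.
  by rewrite -[leLHS]real_normK ?num_real// -[leRHS]real_normK ?num_real// lerXn2r ?nnegrE// norm_sin_le.
nra.
Qed.

(** Sum-to-product formulas. This is an exact mean value identity: the last factor is the derivative
    of [a cos + b sin] at the midpoint. *)
Lemma cos_sin_sub a b x y :
  a * cos x + b * sin x - (a * cos y + b * sin y) =
  2 * sin ((x - y) / 2) * (b * cos ((x + y) / 2) - a * sin ((x + y) / 2)).
Proof.
set d := (x - y) / 2; set m := (x + y) / 2.
have -> : x = m + d by rewrite /m /d; field.
have -> : y = m - d by rewrite /m /d; field.
by rewrite !cosD !sinD cosN sinN; ring.
Qed.

Lemma cos_sin_norm a b x : `|a * cos x + b * sin x| <= `|a| + `|b|.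
Proof.
rewrite (le_trans (ler_normD _ _))// !normrM.
by rewrite lerD// ler_piMr// ?cos_max ?sin_max.
Qed.

Lemma cos_sin_normB a b x : `|b * cos x - a * sin x| <= `|a| + `|b|.
Proof. by have := cos_sin_norm b (- a) x; rewrite mulNr normrN [leRHS]addrC. Qed.

Lemma cos_sin_lipschitz a b x y :
  `|b * cos x - a * sin x| <=
  `|b * cos y - a * sin y| + (`|a| + `|b|) * `|x - y|.
Proof.
have := cos_sin_sub b (- a) x y; rewrite !mulNr.
set U := _ - a * sin x; set V := _ - a * sin y => E.
have -> : U = V + (U - V) by ring.
rewrite (le_trans (ler_normD _ _))// lerD2l E 2!normrM [leRHS]mulrC ler_pM ?mulr_ge0//; last first.
- rewrite [leLHS](_ : _ = `|- a * cos ((x + y) / 2) - b * sin ((x + y) / 2)|).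
    by rewrite (le_trans (cos_sin_normB _ _ _))// normrN addrC.
  by rewrite mulNr.
- have := norm_sin_le ((x - y) / 2).
  rewrite normrM normfV [`|2|]ger0_norm//; lra.
Qed.

(** The two values differ by at most [2 * eta], and by [cos_sin_sub] they differ by at least
    [2 * (|x - y| / 4) * kappa], the midpoint lying in the interval. *)
Lemma cos_sin_close a b c (alpha beta eta kappa x y : R) :
  {in `[alpha, beta], forall z, kappa <= `|b * cos z - a * sin z|} ->
  x \in `[alpha, beta] -> y \in `[alpha, beta] -> `|x - y| <= 1 ->
  0 <= kappa ->
  `|a * cos x + b * sin x + c| <= eta -> `|a * cos y + b * sin y + c| <= eta ->
  kappa * `|x - y| <= 4 * eta.
Proof.
move=> H xI yI xy k0 fx fy.
have mI : (x + y) / 2 \in `[alpha, beta].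
  by move: xI yI; rewrite !in_itv /= => /andP[? ?] /andP[? ?]; apply/andP; split; lra.
have := H _ mI; have := cos_sin_sub a b x y.
set g := (b * _ - _) => E gk.
have : `|2 * sin ((x - y) / 2) * g| <= 2 * eta.
  rewrite -E [X in `|X|](_ : _ = (a * cos x + b * sin x + c) -
    (a * cos y + b * sin y + c)); last by ring.
  by rewrite (le_trans (ler_normB _ _))// mulr_natl mulr2n lerD.
have := @norm_sin_ge ((x - y) / 2).
rewrite !normrM normfV [`|2|]ger0_norm// => /(_ ltac:(lra)) h1 h2.
have : `|x - y| / 2 / 2 * kappa <= `|sin ((x - y) / 2)| * `|g|.
  by rewrite ler_pM// !divr_ge0.
nra.
Qed.

(** Up to sign the two quantities are cross products of [(a, b)] with unit vectors. A vector nearly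
    parallel to two distinct directions is short: [(a^2 + b^2) sin (x - y)] is a combination of the
    two cross products, with coefficients at most [|a| + |b|]. *)
Lemma cos_sin_rotation_close a b (eta x y : R) : `|x - y| <= 1 ->
  `|b * cos x - a * sin x| <= eta -> `|b * cos y - a * sin y| <= eta ->
  (`|a| + `|b|) * `|x - y| <= 8 * eta.
Proof.
move=> xy gx gy.
have eta0 : 0 <= eta by exact: le_trans gx.
have [ab0|ab0] := leP (`|a| + `|b|) 0.
  by rewrite (@le_trans _ _ 0)// ?mulr_ge0// mulr_le0_ge0.
have E : (a ^+ 2 + b ^+ 2) * sin (x - y) =
   (b * cos y - a * sin y) * (a * cos x + b * sin x) -
   (b * cos x - a * sin x) * (a * cos y + b * sin y).
  by rewrite sinB; ring.
have : `|(a ^+ 2 + b ^+ 2) * sin (x - y)| <= 2 * (eta * (`|a| + `|b|)).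
  rewrite E (le_trans (ler_normB _ _))// mulr_natl mulr2n.
  by apply: lerD; rewrite normrM; apply: ler_pM => //; exact: cos_sin_norm.
rewrite normrM ger0_norm; last by rewrite addr_ge0// sqr_ge0.
have := norm_sin_ge xy; set s := `|sin _| => hs.
rewrite -[a ^+ 2]real_normK ?num_real// -[b ^+ 2]real_normK ?num_real//.
set A := `|a| in ab0 *; set B := `|b| in ab0 * => h.
have A0 : 0 <= A by exact: normr_ge0.
have B0 : 0 <= B by exact: normr_ge0.
have : (A + B) ^+ 2 / 2 * (`|x - y| / 2) <= (A ^+ 2 + B ^+ 2) * s.
  rewrite ler_pM// ?divr_ge0 ?sqr_ge0//.
  by have := sqr_ge0 (A - B); lra.
move=> /le_trans /(_ h); set t := `|x - y| => k.
have : (A + B) * ((A + B) * t) <= (A + B) * (8 * eta) by lra.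
by rewrite ler_pM2l.
Qed.
End Trigonometry.

(** * Energy of transversal families *)

Section FiniteOverlaps.
Context d (T : measurableType d) {R : realType}.
Context (mu : {measure set T -> \bar R}) {I : Type} (A : I -> set T).
Hypothesis mA : forall i, measurable (A i).
Implicit Types (s : seq I) (B : set T).

Definition overlap s (x : T) : R := \sum_(i <- s) \1_(A i) x.

Lemma overlap_ge0 s x : 0 <= overlap s x.
Proof. by rewrite /overlap sumr_ge0. Qed.

Lemma measurable_overlap s : measurable_fun setT (overlap s).
Proof. by apply: measurable_sum => i; exact: measurable_indic. Qed.

Lemma measurable_overlap_ge s (nu : R) : measurable [set x | nu <= overlap s x].
Proof.
rewrite [X in measurable X](_ : _ = overlap s @^-1` `[nu, +oo[).
  rewrite -[X in measurable X]setTI; exact: measurable_overlap.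
by apply/seteqP; split => x /=; rewrite in_itv /= andbT.
Qed.

Lemma integral_overlap s :
  (\int[mu]_x (overlap s x)%:E)%E = (\sum_(i <- s) mu (A i))%E.
Proof.
under eq_integral do rewrite /overlap -sumEFin.
rewrite ge0_integral_sum//.
- by apply: eq_bigr => i _; rewrite integral_indic// setIT.
- by move=> i; apply/measurable_EFinP; exact: measurable_indic.
Qed.

Lemma overlap_markov s (nu : R) : 0 <= nu ->
  (nu%:E * mu [set x | (nu <= overlap s x)%R] <= \sum_(i <- s) mu (A i))%E.
Proof.
move=> nu0; set B := [set x | _].
have mB : measurable B by exact: measurable_overlap_ge.
rewrite -[mu B](_ : (\int[mu]_x (\1_B x)%:E)%E = _); last first.
  by rewrite integral_indic// setIT.
rewrite -ge0_integralZl//; last first.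
- by apply/measurable_EFinP; exact: measurable_indic.
- rewrite -integral_overlap; apply: ge0_le_integral => //=.
  + by move=> x _; rewrite -EFinM lee_fin mulr_ge0.
  + apply: emeasurable_funM; first exact: measurable_cst.
    by apply/measurable_EFinP; exact: measurable_indic.
  + by apply/measurable_EFinP; exact: measurable_overlap.
  + move=> x _; rewrite -EFinM lee_fin indicE.
    case: (boolP (x \in B)) => [/set_mem xB|_]; rewrite ?mulr1// mulr0.
    exact: overlap_ge0.
Qed.

(** The hypothesis on [overlap] says that the listed sets are pairwise disjoint and contained in
    [B]. *)
Lemma sum_measure_le s B : measurable B -> (forall x, overlap s x <= \1_B x) ->
  (\sum_(i <- s) mu (A i) <= mu B)%E.
Proof.
move=> mB AB; rewrite -integral_overlap.
rewrite -[leRHS](_ : (\int[mu]_x (\1_B x)%:E)%E = _); last first.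
  by rewrite integral_indic// setIT.
apply: ge0_le_integral => //=.
- by move=> x _; rewrite lee_fin overlap_ge0.
- by apply/measurable_EFinP; exact: measurable_overlap.
- by apply/measurable_EFinP; exact: measurable_indic.
- by move=> x _; rewrite lee_fin AB.
Qed.
End FiniteOverlaps.

Lemma measure_le_diameter (R : realType) (S : set R) (d : R) :
  measurable S -> 0 <= d -> (forall x y, S x -> S y -> `|x - y| <= d) ->
  (lebesgue_measure S <= (2 * d)%:E)%E.
Proof.
move=> mS d0 Sd; have [->|/set0P[x Sx]] := eqVneq S set0.
  by rewrite measure0 lee_fin mulr_ge0.
apply: (@le_trans _ _ (lebesgue_measure `[x - d, x + d]%classic)).
  apply: le_measure; rewrite ?inE// => y Sy /=.
  by have := Sd _ _ Sy Sx; rewrite in_itv /= -ler_distl.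
rewrite lebesgue_measure_itv /=; case: ifP => _; rewrite ?lee_fin ?mulr_ge0//.
lra.
Qed.

Lemma sum_const_seq (R : pzRingType) (J : Type) (s : seq J) (c : R) :
  \sum_(i <- s) c = (size s)%:R * c.
Proof. by rewrite big_const_seq count_predT iter_addr addr0 mulr_natl. Qed.

Section Energy.
Context {R : realType} {T : eqType}.
Variables (I : seq T) (rho : R).
Hypotheses (uI : uniq I) (rho0 : 0 <= rho).
Let N : R := (size I)%:R.

(* Pairs of words with a common first letter rescale to pairs of shorter words. *)
Lemma energy_recursion (m : nat -> seq T -> seq T -> R) (B : R) :
  (forall k i u v, m k.+1 (i :: u) (i :: v) = m k u v) ->
  (forall k i j u v, i \in I -> j \in I -> i != j ->
     u \in words I k -> v \in words I k ->
     m k.+1 (i :: u) (j :: v) <= B * rho ^+ k.+1) ->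
  m 0%N [::] [::] <= 1 -> 0 <= B ->
  forall k, \sum_(u <- words I k) \sum_(v <- words I k) m k u v <=
    N ^+ k * (1 + B * \sum_(j < k) (N * rho) ^+ j.+1).
Proof.
move=> mS mB m0 B0; elim=> [|k IH].
  by rewrite !big_seq1 expr0 big_ord0 mulr0 addr0 mul1r.
set e := (X in X <= _) in IH.
(* The letter [j = i] reproduces the energy of level [k]; the other letters give at most
   [N * N ^+ (2 * k)] pairs, each controlled by [mB]. *)
have diag i : i \in I -> \sum_(u <- words I k) \sum_(j <- I) \sum_(v <- words I k)
    m k.+1 (i :: u) (j :: v) <= e + N * N ^+ (2 * k) * (B * rho ^+ k.+1).
  move=> iI; rewrite exchange_big /= (bigD1_seq i)//= lerD//.
    by apply: ler_sum => u _; apply: ler_sum => v _; rewrite mS.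
  apply: (@le_trans _ _ (\sum_(j <- I) \sum_(u <- words I k) \sum_(v <- words I k)
    B * rho ^+ k.+1)); last first.
    rewrite !sum_const_seq !size_words natrX -/N mulrA mul2n -addnn exprD.
    by rewrite !mulrA.
  rewrite big_mkcond /= big_seq [leRHS]big_seq; apply: ler_sum => j jI.
  case: ifP => [ji|_]; last first.
    by do 2!(apply: sumr_ge0 => ? _); rewrite mulr_ge0 ?exprn_ge0.
  rewrite big_seq [leRHS]big_seq; apply: ler_sum => u uW.
  rewrite big_seq [leRHS]big_seq; apply: ler_sum => v vW.
  by rewrite mB// eq_sym.
have : \sum_(u <- words I k.+1) \sum_(v <- words I k.+1) m k.+1 u v <=
    N * (e + N * N ^+ (2 * k) * (B * rho ^+ k.+1)).
  rewrite /= big_allpairs_dep /=.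
  under eq_bigr do under eq_bigr do rewrite big_allpairs_dep /=.
  apply: (@le_trans _ _ (\sum_(i <- I) (e + N * N ^+ (2 * k) * (B * rho ^+ k.+1)))).
    by rewrite big_seq [leRHS]big_seq; apply: ler_sum => i /diag.
  by rewrite sum_const_seq.
move/le_trans; apply.
(* The off-diagonal part equals [N ^+ k.+1 * B * (N * rho) ^+ k.+1], which is the next term of the
   geometric sum. *)
have : N * e <= N * (N ^+ k * (1 + B * \sum_(j < k) (N * rho) ^+ j.+1)).
  by rewrite ler_wpM2l.
rewrite big_ord_recr /= !exprMn mul2n -addnn !exprD !exprS => h.
lra.
Qed.
End Energy.

(** The first letter is the outermost map. The base point is a parameter because letting it range
    over [K] describes the whole piece coded by [w], not just one point of it. *)
Definition word_point (R : pzRingType) (T : Type) (rho : R) (d : T -> R) (x0 : R)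
    (w : seq T) : R := foldr (fun t x => rho * x + d t) x0 w.

Section TransversalFamily.
Context {R : realType} {T : eqType}.
Variables (I : seq T) (rho : R) (F : T -> R -> R) (F0 : R -> R).
Variables (alpha beta C L : R).
Let X w theta := word_point rho (F ^~ theta) (F0 theta) w.
Let N : R := (size I)%:R.
Hypotheses (uI : uniq I) (rho0 : 0 < rho) (C0 : 0 <= C) (L0 : 0 <= L).
Hypotheses (ab1 : beta - alpha <= 1).
Hypotheses (mF : forall t, measurable_fun setT (F t)) (mF0 : measurable_fun setT F0).
Hypothesis transversal : forall k i j u v (theta theta' eta : R),
  i \in I -> j \in I -> i != j -> u \in words I k -> v \in words I k ->
  theta \in `[alpha, beta] -> theta' \in `[alpha, beta] ->
  `|X (i :: u) theta - X (j :: v) theta| <= eta ->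
  `|X (i :: u) theta' - X (j :: v) theta'| <= eta ->
  `|theta - theta'| <= C * eta.

Let near k (uv : seq T * seq T) : set R :=
  [set theta | theta \in `[alpha, beta] /\
    `|X uv.1 theta - X uv.2 theta| <= L * rho ^+ k].

Let measurable_X w : measurable_fun setT (X w).
Proof.
elim: w => //= t w IH; apply: measurable_funD => //.
exact: measurable_funM.
Qed.

Let measurable_near k uv : measurable (near k uv).
Proof.
rewrite [X in measurable X](_ : _ = `[alpha, beta] `&`
    ((fun theta => `|X uv.1 theta - X uv.2 theta|) @^-1` `]-oo, L * rho ^+ k])).
  apply: measurableI => //; rewrite -[X in measurable X]setTI.
  have : measurable_fun setT (fun theta => `|X uv.1 theta - X uv.2 theta|).
    by apply: measurableT_comp => //; exact: measurable_funB.
  exact.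
by apply/seteqP; split => x /=; rewrite [_ \in `]-oo, _]]in_itv.
Qed.

Let near_le1 k uv : (lebesgue_measure (near k uv) <= 1%:E)%E.
Proof.
apply: (@le_trans _ _ (lebesgue_measure `[alpha, beta]%classic)).
  apply: le_measure; rewrite ?inE//; first exact: measurable_near.
  by move=> x [].
rewrite lebesgue_measure_itv /=; case: ifP => _; rewrite ?lee_fin//.
Qed.

(** [energy_recursion] with [m] the measure of [near]. A common first letter scales both the
    difference and the threshold by [rho]. For distinct first letters, transversality bounds the
    diameter of [near] by [C * L * rho ^+ k.+1], hence its measure by twice that. *)
Lemma sum_measure_close_words k :
  (\sum_(uv <- [seq (u, v) | u <- words I k, v <- words I k])
     lebesgue_measure (near k uv) <=
   (N ^+ k * (1 + 2 * C * L * \sum_(j < k) (N * rho) ^+ j.+1))%:E)%E.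
Proof.
have fin k' uv : lebesgue_measure (near k' uv) \is a fin_num.
  by rewrite ge0_fin_numE// (le_lt_trans (near_le1 _ _))// ltry.
rewrite (eq_bigr (fun uv => (fine (lebesgue_measure (near k uv)))%:E)); last first.
  by move=> uv _; rewrite fineK.
rewrite sumEFin lee_fin big_allpairs_dep /=.
apply: (@energy_recursion _ _ I rho uI (ltW rho0)
  (fun k u v => fine (lebesgue_measure (near k (u, v))))) => //.
- move=> k' i u v; congr (fine (lebesgue_measure _)).
  apply/funext => x /=; congr (_ /\ (is_true _)).
  rewrite /X /= opprD addrACA subrr addr0 -mulrBr normrM gtr0_norm//.
  by rewrite exprS mulrCA ler_pM2l.
- move=> k' i j u v iI jI ij uW vW; rewrite -lee_fin fineK//.
  rewrite (_ : 2 * C * L * _ = 2 * (C * (L * rho ^+ k'.+1))); last by rewrite !mulrA.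
  apply: measure_le_diameter; first exact: measurable_near.
    by apply: mulr_ge0 => //; apply: mulr_ge0 => //; exact: exprn_ge0 (ltW rho0).
  by move=> x y [xI hx] [yI hy]; exact: (transversal iI jI ij uW vW xI yI hx hy).
- by rewrite -lee_fin fineK.
- by rewrite !mulr_ge0.
Qed.

(** [B] collects the parameters with at least [nu] close pairs, and Markov's inequality bounds its
    measure. Off [B], [weak_turan] for the closeness relation yields [W]. *)
Lemma separated_words k (nu : R) : 0 <= nu -> exists B : set R, [/\ measurable B,
  (nu%:E * lebesgue_measure B <=
    (N ^+ k * (1 + 2 * C * L * \sum_(j < k) (N * rho) ^+ j.+1))%:E)%E &
  forall theta, theta \in `[alpha, beta] -> ~ B theta ->
    exists W : seq (seq T), [/\ {subset W <= words I k}, uniq W,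
      {in W &, forall u v, u != v -> L * rho ^+ k < `|X u theta - X v theta|} &
      N ^+ (2 * k) <= 4 * (size W)%:R * nu]].
Proof.
move=> nu0; pose P := [seq (u, v) | u <- words I k, v <- words I k].
exists [set x | nu <= overlap (near k) P x]; split.
- exact: measurable_overlap_ge.
- apply: le_trans (sum_measure_close_words k).
  exact: (overlap_markov lebesgue_measure (measurable_near k)).
- move=> theta thI /negP; rewrite -ltNge => hnu.
  pose r (u v : seq T) := `|X u theta - X v theta| <= L * rho ^+ k.
  have rr : reflexive r.
    by move=> u; rewrite /r subrr normr0; apply: mulr_ge0 => //; exact: exprn_ge0 (ltW rho0).
  have rs : symmetric r by move=> u v; rewrite /r distrC.
  have [W [WI uW sW tW]] := weak_turan (words I k) rr rs.
  exists W; split=> //.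
    by move=> u v uW' vW' uv; rewrite ltNge; exact: sW.
  have : (size (words I k) ^ 2)%:R <= (4 * size W *
      \sum_(u <- words I k) count (r u) (words I k))%:R :> R by rewrite ler_nat.
  rewrite size_words natrX natrX -exprM mulnC => /le_trans; apply.
  rewrite !natrM ler_wpM2l ?mulr_ge0//; apply: le_trans (ltW hnu).
  rewrite /overlap big_allpairs_dep /= natr_sum; apply: ler_sum => u _.
  rewrite -sum1_count natr_sum [leLHS]big_mkcond /=; apply: ler_sum => v _.
  rewrite indicE; case: ifP => // ruv; rewrite mem_set//.
Qed.
End TransversalFamily.

(** * Packing in null compact sets *)

Section SmallSets.
Context d (T : measurableType d) {R : realType} (mu : {measure set T -> \bar R}).

Lemma negligible_small (A : set T) :
  (forall e : R, 0 < e -> exists D : set T,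
     [/\ measurable D, A `<=` D & (mu D <= e%:E)%E]) ->
  mu.-negligible A.
Proof.
move=> H; have /choice[D HD] : forall n : nat, exists D : set T,
    [/\ measurable D, A `<=` D & (mu D <= (n.+1%:R^-1)%:E)%E].
  by move=> n; apply: H; rewrite invr_gt0.
exists (\bigcap_n D n); split.
- by apply: bigcapT_measurable => n; have [] := HD n.
- apply/eqP; rewrite eq_le measure_ge0 andbT; apply/lee_addgt0Pr => e e0.
  rewrite add0e; have [n hn] : exists n, n.+1%:R^-1 < e.
    exists (Num.trunc e^-1); rewrite -[ltRHS]invrK ltf_pV2 ?posrE ?invr_gt0//.
    exact: truncnS_gt.
  have [mD _ Dn] := HD n.
  apply: (@le_trans _ _ (mu (D n))); last first.
    by apply: le_trans Dn _; rewrite lee_fin ltW.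
  apply: le_measure; rewrite ?inE//; last exact: bigcap_inf.
  by apply: bigcapT_measurable => k; have [] := HD k.
- by move=> x Ax n _; have [_ + _] := HD n; exact.
Qed.

(** Continuity from below: the inner intersections increase with [n], and the one of index [n] lies
    in [B n]. A uniform bound suffices because a point of the union is in all [B k] from some [k]
    on; no summability is involved. *)
Lemma measure_eventually_le (B : (set T)^nat) (x : \bar R) :
  (forall k, measurable (B k)) -> (forall k, (mu (B k) <= x)%E) ->
  (mu (\bigcup_n \bigcap_(k in [set k | (n <= k)%N]) B k) <= x)%E.
Proof.
move=> mB Bx; pose G n := \bigcap_(k in [set k | (n <= k)%N]) B k.
have mG n : measurable (G n) by apply: bigcap_measurableType => k _; exact: mB.
have cv : mu \o G @ \oo --> mu (\bigcup_n G n).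
  apply: nondecreasing_cvg_mu => //; first exact: bigcupT_measurable.
  move=> n m nm; apply/subsetPset => y Gy k /= mk; apply: Gy => /=.
  exact: leq_trans mk.
rewrite -(cvg_lim _ cv)//; apply: lime_le; first by apply/cvg_ex; eexists; exact: cv.
apply: nearW => n /=; apply: le_trans (Bx n).
by apply: le_measure; rewrite ?inE//; apply: bigcap_inf => /=.
Qed.
End SmallSets.

(** Outer regularity gives an open [U] containing [S] of measure at most [eps], and compactness
    gives a radius [r] whose neighbourhood of [S] stays in [U]. The balls of radius [delta / 2]
    about the points [p w] are then disjoint, lie in [U], and have length [delta]. *)
Lemma null_compact_packing (R : realType) (S : set R) (eps : R) :
  compact S -> lebesgue_measure S = 0%E -> 0 < eps ->
  exists2 r : R, 0 < r & forall (J : eqType) (W : seq J) (p : J -> R) (delta : R),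
    uniq W -> 0 < delta < r -> {in W, forall w, S (p w)} ->
    {in W &, forall u v, u != v -> delta < `|p u - p v|} ->
    (size W)%:R * delta <= eps.
Proof.
move=> cS S0 eps0.
have mS : measurable S by exact: compact_measurable.
have [|U [oU SU muU]] := @lebesgue_regularity_outer R S eps mS _ eps0.
  exact: compact_finite_measure.
have mU : measurable U by exact: open_measurable.
have {}muU : (lebesgue_measure U <= eps%:E)%E.
  apply: le_trans (ltW muU).
  rewrite -[leRHS]adde0 -[X in (_ + X)%E]S0.
  rewrite -{1}(setDKU SU); apply: measureU2 => //.
  exact: measurableD.
have [e /= e0 eU] : \forall r \near 0^'+, S `<=` (fun x => ball x r `<=` U).
  move/compact_near_coveringP : cS; apply => x /SU Ux.
  have /nbhs_ballP[e /= e0 eU] : nbhs x U by exact: open_nbhs_nbhs.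
  exists (ball x (e / 2), [set r | r < e / 2]) => /=.
    by split; [apply: nbhsx_ballx|apply: nbhs_right_lt]; rewrite divr_gt0.
  move=> [y r] /= [xy re] z yz; apply: eU.
  apply: (@ball_split _ _ y); first exact: xy. exact: le_ball (ltW re) _ yz.
exists e => // J W p delta uW /andP[d0 de] pS sep.
have d20 : 0 < delta / 2 by rewrite divr_gt0.
pose A w : set R := ball (p w) (delta / 2).
have mA w : measurable (A w) by exact: measurable_ball.
rewrite -lee_fin (le_trans _ muU)//.
rewrite -[leLHS](_ : (\sum_(w <- W) lebesgue_measure (A w))%E = _); last first.
  rewrite (eq_bigr (fun _ => delta%:E)) ?sumEFin ?sum_const_seq// => w _.
  by rewrite lebesgue_measure_ball ?ltW// mulr2n -splitr.
apply: (sum_measure_le lebesgue_measure mA) => //.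
suff: forall x : R, overlap A W x <= \1_U x :> R by [].
move=> x.
have [/hasP[w wW xw]|nW] := boolP (has (fun w => x \in A w) W); last first.
  rewrite /overlap big_seq big1 ?ler0n// => w wW.
  by rewrite indicE; case: (boolP (x \in A w)) => // xw; case/negP: nW; apply/hasP; exists w.
have Ux : U x.
  apply: (eU delta) (pS _ wW) _ _ => //; first by rewrite /= sub0r normrN gtr0_norm.
  by move/set_mem: xw; apply: le_ball; lra.
rewrite /overlap (bigD1_seq w)//= !indicE xw mem_set// big_seq_cond big1 ?addr0//.
move=> v /andP[vW vw]; rewrite indicE; case: (boolP (x \in A v)) => // xv.
have := sep _ _ vW wW vw; move/set_mem: xw; move/set_mem: xv.
rewrite /A /ball /= => xv xw; rewrite ltNge => /negP[].
rewrite (_ : p v - p w = (p v - x) - (p w - x)); last by ring.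
by rewrite (le_trans (ler_normB _ _))//; lra.
Qed.

(** * Projections of transversal systems *)

Lemma geometric_sum_lt1 (R : realFieldType) (x : R) k : 0 <= x < 1 ->
  \sum_(j < k) x ^+ j.+1 <= (1 - x)^-1.
Proof.
move=> /andP[x0 x1]; have d0 : 0 < 1 - x by rewrite subr_gt0.
suff : (1 - x) * \sum_(j < k) x ^+ j.+1 <= 1 by rewrite -ler_pdivlMl// mulr1.
suff -> : (1 - x) * \sum_(j < k) x ^+ j.+1 = x - x ^+ k.+1.
  by have : 0 <= x ^+ k.+1 := exprn_ge0 _ x0; lra.
elim: k => [|k IH]; first by rewrite big_ord0 mulr0 expr1 subrr.
by rewrite big_ord_recr /= mulrDr IH [x ^+ k.+2]exprS; ring.
Qed.

(** Above ratio 1 the last term dominates. With [x = N * rho] this is the energy bound in similarity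
    dimension greater than 1. *)
Lemma geometric_sum_gt1 (R : realFieldType) (x c : R) k : 1 < x -> 0 <= c ->
  1 + c * \sum_(j < k) x ^+ j.+1 <= (1 + c * (x / (x - 1))) * x ^+ k.
Proof.
move=> x1 c0; have d0 : 0 < x - 1 by rewrite subr_gt0.
have xk : 1 <= x ^+ k by rewrite exprn_ege1// ltW.
have E : (x - 1) * \sum_(j < k) x ^+ j.+1 = x * x ^+ k - x.
  elim: k {xk} => [|k IH]; first by rewrite big_ord0 mulr0 expr0 mulr1 subrr.
  by rewrite big_ord_recr /= mulrDr IH exprS; ring.
have S_le : \sum_(j < k) x ^+ j.+1 <= x / (x - 1) * x ^+ k.
  by rewrite mulrAC ler_pdivlMr// mulrC E gerDl oppr_le0 (le_trans ler01)// ltW.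
by rewrite mulrDl mul1r lerD// -mulrA ler_wpM2l.
Qed.

Lemma exprn_eventually_lt (R : realType) (x r : R) : 0 < x < 1 -> 0 < r ->
  exists n, forall k, (n <= k)%N -> x ^+ k < r.
Proof.
move=> /andP[x0 x1] r0.
have /cvgrPdist_lt/(_ _ r0)[n _ H] : x ^+ k @[k --> \oo] --> 0.
  by apply: cvg_expr; rewrite ger0_norm// ltW.
exists n => k /H /=; rewrite sub0r normrN ger0_norm//.
exact: exprn_ge0 (ltW x0).
Qed.

Section WordPoints.
Context {R : realType} {T : eqType}.

Lemma word_point_mem (I : seq T) (rho x0 : R) (d : T -> R) (K : set R) w :
  {in I, forall t y, K y -> K (rho * y + d t)} -> K x0 -> all (mem I) w ->
  K (word_point rho d x0 w).
Proof. by move=> dK Kx0; elim: w => //= t w IH /andP[tI /IH]; exact: dK. Qed.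

(** Projecting commutes with coding, so the projected words again form a family of [word_point]
    type, based at the projection of [(x0, x0, x0)]. *)
Lemma word_point_linear (rho x0 p q : R) (a b c : T -> R) w :
  word_point rho (fun t => a t * p + b t * q + c t) (x0 * p + x0 * q + x0) w =
  word_point rho a x0 w * p + word_point rho b x0 w * q + word_point rho c x0 w.
Proof. by elim: w => //= t w ->; ring. Qed.
End WordPoints.

Section Projections.
Context {R : realType}.
Implicit Types K : set R.

Definition circle_sum K (theta : R) : set R :=
  add_set (add_set (scale_set (cos theta) K) (scale_set (sin theta) K)) K.

Lemma mem_circle_sum K theta x y z : K x -> K y -> K z ->
  circle_sum K theta (x * cos theta + y * sin theta + z).
Proof.
move=> Kx Ky Kz; exists (x * cos theta + y * sin theta); last by exists z.
exists (x * cos theta); first by exists x; rewrite // mulrC.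
by exists (y * sin theta) => //; exists y; rewrite // mulrC.
Qed.

Lemma compact_circle_sum K theta : compact K -> compact (circle_sum K theta).
Proof.
move=> cK; pose f (p : R * R * R) := cos theta * p.1.1 + sin theta * p.1.2 + p.2.
rewrite (_ : circle_sum K theta = f @` ((K `*` K) `*` K)).
  apply: continuous_compact; last by apply: compact_setX => //; exact: compact_setX.
  apply: continuous_subspaceT => p; apply: cvgD; last exact: cvg_snd.
  apply: cvgD; (apply: cvgM; first exact: cvg_cst).
    by apply: (@continuous_comp _ _ _ fst fst); exact: cvg_fst.
  by apply: (@continuous_comp _ _ _ fst snd); [exact: cvg_fst|exact: cvg_snd].
apply/seteqP; split => [s [t [u [x Kx <-] [v [y Ky <-] <-]] [z Kz <-]]|s [[[x y] z]]].
  by exists (x, y, z).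
move=> /= [[Kx Ky] Kz] <-; rewrite /f /= [cos _ * _]mulrC [sin _ * _]mulrC.
exact: mem_circle_sum.
Qed.

(** If the compact sum is null at [theta], packing at scale [rho ^+ k] excludes many separated words
    for every large [k]. So [theta] lies in all late exceptional sets of [separated_words], whose
    measures are uniformly small. *)
Lemma negligible_transversal_circle_sum (T : eqType) (I : seq T) (a b c : T -> R)
    K (rho x0 alpha beta C : R) :
  compact K -> K x0 -> uniq I -> 0 < rho < 1 -> 1 < (size I)%:R * rho ->
  0 <= C -> beta - alpha <= 1 ->
  {in I, forall t y, K y -> [/\ K (rho * y + a t), K (rho * y + b t) &
                               K (rho * y + c t)]} ->
  (forall k i j u v (theta theta' eta : R),
     i \in I -> j \in I -> i != j -> u \in words I k -> v \in words I k ->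
     theta \in `[alpha, beta] -> theta' \in `[alpha, beta] ->
     let f x := (word_point rho a x0 (i :: u) - word_point rho a x0 (j :: v)) * cos x +
       (word_point rho b x0 (i :: u) - word_point rho b x0 (j :: v)) * sin x +
       (word_point rho c x0 (i :: u) - word_point rho c x0 (j :: v)) in
     `|f theta| <= eta -> `|f theta'| <= eta -> `|theta - theta'| <= C * eta) ->
  lebesgue_measure.-negligible
    [set theta | theta \in `[alpha, beta] /\
       ~ (0 < lebesgue_measure (circle_sum K theta))%E].
Proof.
move=> cK Kx0 uI /andP[rho0 rho1] Nrho C0 ab1 abcK trans.
have [aK bK cK'] : [/\ {in I, forall t y, K y -> K (rho * y + a t)},
    {in I, forall t y, K y -> K (rho * y + b t)} &
    {in I, forall t y, K y -> K (rho * y + c t)}].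
  by split=> t tI y /(abcK _ tI)[].
pose F t theta := a t * cos theta + b t * sin theta + c t.
pose F0 theta := x0 * cos theta + x0 * sin theta + x0.
pose X w theta := word_point rho (F ^~ theta) (F0 theta) w.
have XE w theta : X w theta = word_point rho a x0 w * cos theta +
    word_point rho b x0 w * sin theta + word_point rho c x0 w.
  exact: word_point_linear.
have mF (p q r : R) : measurable_fun setT (fun th => p * cos th + q * sin th + r).
  apply: measurable_funD => //; apply: measurable_funD => //.
    by apply: measurable_funM => //; apply: continuous_measurable_fun; exact: continuous_cos.
  by apply: measurable_funM => //; apply: continuous_measurable_fun; exact: continuous_sin.
have transX k i j u v (th th' eta : R) : i \in I -> j \in I -> i != j ->
    u \in words I k -> v \in words I k ->
    th \in `[alpha, beta] -> th' \in `[alpha, beta] ->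
    `|X (i :: u) th - X (j :: v) th| <= eta ->
    `|X (i :: u) th' - X (j :: v) th'| <= eta -> `|th - th'| <= C * eta.
  move=> iI jI ij uW vW thI thI' h h'; apply: (trans k i j u v) => //=.
  - by apply: le_trans h; rewrite !XE /= le_eqVlt; apply/orP; left; apply/eqP;
      congr `|_|; ring.
  - by apply: le_trans h'; rewrite !XE /= le_eqVlt; apply/orP; left; apply/eqP;
      congr `|_|; ring.
have sepw k := separated_words uI rho0 C0 ler01 ab1 (fun t => mF (a t) (b t) (c t))
  (mF x0 x0 x0) transX k.
set N : R := (size I)%:R in Nrho sepw.
have N0 : 0 < N by rewrite -(pmulr_lgt0 _ rho0); exact: lt_trans Nrho.
pose H := 1 + 2 * C * 1 * ((N * rho) / (N * rho - 1)).
have H0 : 0 < H.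
  apply: ltr_pwDl => //; apply: mulr_ge0; first by rewrite mulr1 mulr_ge0.
  by apply: divr_ge0; rewrite ?subr_ge0 ltW// mulr_gt0.
apply: negligible_small => e e0.
(* [eps] and [nu] are tuned together: Markov's inequality gives [B k] measure at most [e], while off
   [B k] one gets [(size W)%:R * rho ^+ k >= eps], twice what packing allows. *)
pose eps := e / (4 * H).
have eps0 : 0 < eps by rewrite divr_gt0// mulr_gt0.
pose nu k := N ^+ (2 * k) * rho ^+ k / (4 * eps).
have nu0 k : 0 < nu k by rewrite !(divr_gt0, mulr_gt0, exprn_gt0).
have [B HB] := choice (fun k => sepw k (nu k) (ltW (nu0 k))).
exists (\bigcup_n \bigcap_(k in [set k | (n <= k)%N]) B k); split.
- apply: bigcupT_measurable => n; apply: bigcap_measurableType => k _.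
  by have [] := HB k.
- move=> theta /= [thI /negP]; rewrite -leNgt => null.
  have cS : compact (circle_sum K theta) by exact: compact_circle_sum.
  have S0 : lebesgue_measure (circle_sum K theta) = 0%E.
    by apply/eqP; rewrite eq_le null measure_ge0.
  have eps20 : 0 < eps / 2 by rewrite divr_gt0.
  have [r r0 pack] := @null_compact_packing R _ _ cS S0 eps20.
  have [n hn] : exists n, forall k, (n <= k)%N -> rho ^+ k < r.
    by apply: exprn_eventually_lt => //; rewrite rho0.
  exists n => // k /= /hn rk; apply: contrapT => nB.
  have [_ _ /(_ _ thI nB)[W [WI uW sW]]] := HB k; apply/negP; rewrite -ltNge.
  have := pack _ W (X ^~ theta) (rho ^+ k) uW; rewrite exprn_gt0// rk.
  have memX : {in W, forall w, circle_sum K theta (X w theta)}.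
    move=> w /WI; rewrite mem_words => /andP[_ wI].
    by rewrite XE; apply: mem_circle_sum; apply: (@word_point_mem _ _ I).
  move=> /(_ isT memX) h.
  have {}h : (size W)%:R * rho ^+ k <= eps / 2.
    by apply: h => u v uW' vW' uv; rewrite -[ltLHS]mul1r; exact: sW.
  rewrite /nu.
  have -> : 4 * (size W)%:R * (N ^+ (2 * k) * rho ^+ k / (4 * eps)) =
     ((size W)%:R * rho ^+ k / eps) * N ^+ (2 * k).
    by field; rewrite gt_eqF.
  rewrite -[ltRHS]mul1r ltr_pM2r ?exprn_gt0// ltr_pdivrMr// mul1r.
  by apply: le_lt_trans h _; rewrite ltr_pdivrMr// mulr_natr mulr2n ltrDl.
- apply: measure_eventually_le => k; first by have [] := HB k.
  have [_ + _] := HB k; move=> h.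
  suff : ((nu k)%:E * lebesgue_measure (B k) <= (nu k)%:E * e%:E)%E.
    by rewrite lee_pmul2l ?lte_fin.
  apply: le_trans h _; rewrite -EFinM lee_fin.
  have Nk : 0 <= N ^+ k by rewrite exprn_ge0// ltW.
  have C1 : 0 <= 2 * C * 1 by rewrite mulr1 mulr_ge0.
  apply: le_trans (ler_wpM2l Nk (geometric_sum_gt1 k Nrho C1)) _; rewrite -/H.
  rewrite /nu /eps exprMn mul2n -addnn exprD le_eqVlt; apply/orP; left; apply/eqP.
  by field; rewrite !gt_eqF.
Qed.
End Projections.

(** * Systems without reflections *)

Section HomogeneousSystem.
Context {R : realType}.
Variables (K : set R) (ds : seq R) (rho x0 c0 D : R).
Hypotheses (cK : compact K) (Kx0 : K x0) (KD : forall y, K y -> `|y| <= D).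
Hypotheses (uds : uniq ds) (rho01 : 0 < rho < 1) (c00 : 0 < c0).
Hypothesis dsK : {in ds, forall t y, K y -> K (rho * y + t)}.
Hypothesis dsep : {in ds &, forall t t', t != t' -> forall y y', K y -> K y' ->
  c0 <= `|rho * y + t - (rho * y' + t')|}.

Let rho0 : 0 < rho. Proof. by case/andP: rho01. Qed.
Let rho1 : rho < 1. Proof. by case/andP: rho01. Qed.

Let ds2 := [seq (s, t) | s <- ds, t <- ds].
Let PA := word_point rho (@fst R R).
Let PB := word_point rho (@snd R R).
Let PC := word_point rho (@id R).

Lemma word_point_base (T : Type) (d : T -> R) (y : R) w :
  word_point rho d y w = rho ^+ size w * y + word_point rho d 0 w.
Proof.
elim: w => [|t w IH] /=; first by rewrite expr0 mul1r addr0.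
by rewrite IH exprS; ring.
Qed.

Let KPA w y : all (mem ds2) w -> K y -> K (PA y w).
Proof.
move=> wI Ky; apply: (@word_point_mem _ _ ds2) => // -[s t].
by case/allpairsP => -[? ?] [/= h1 h2 [-> _]] z /dsK; exact.
Qed.

Let KPB w y : all (mem ds2) w -> K y -> K (PB y w).
Proof.
move=> wI Ky; apply: (@word_point_mem _ _ ds2) => // -[s t].
by case/allpairsP => -[? ?] [/= h1 h2 [_ ->]] z /dsK; exact.
Qed.

Let KPC w y : all (mem ds) w -> K y -> K (PC y w).
Proof. by move=> wI Ky; apply: (@word_point_mem _ _ ds). Qed.

Let K2D y y' : K y -> K y' -> `|y - y'| <= 2 * D.
Proof.
move=> /KD h /KD h'; rewrite (le_trans (ler_normB _ _))//.
by rewrite mulr_natl mulr2n lerD.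
Qed.

Let D0 : 0 <= D. Proof. by apply: le_trans (KD Kx0). Qed.

(** Each common leading letter contracts the distance by exactly [rho]; at the first differing
    letter [dsep] provides [c0]. *)
Lemma word_separation n w w' y y' : w \in words ds n -> w' \in words ds n ->
  w != w' -> K y -> K y' -> c0 * rho ^+ n <= `|PC y w - PC y' w'|.
Proof.
move=> + + + Ky Ky'; elim: n w w' => [|n IH] w w'.
  by rewrite !inE => /eqP -> /eqP ->; rewrite eqxx.
rewrite !mem_words; case: w w' => [|t w] [|t' w'] //=.
rewrite !eqSS => /and3P[sw tI wI] /and3P[sw' tI' wI'].
have [<-{t' tI'}|tt' _] := eqVneq t t'.
  rewrite eqseq_cons eqxx /= => ww'.
  rewrite opprD addrACA subrr addr0 -mulrBr normrM gtr0_norm// exprS mulrCA.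
  by rewrite ler_pM2l//; apply: IH; rewrite // mem_words ?sw ?sw'.
apply: (@le_trans _ _ c0).
  by apply: ler_piMr; [exact: ltW|apply: exprn_ile1; exact: ltW].
by apply: dsep => //; exact: KPC.
Qed.

(** * Angles near one with separated planar digits *)

Section Local.
Variables (n : nat) (W : seq (seq (R * R))) (theta0 alpha beta : R).
Hypotheses (n0 : (0 < n)%N) (uW : uniq W) (WI : {subset W <= words ds2 n}).
(* Replacing the base point by arbitrary points of [K] perturbs the difference of
   two level-n pieces by at most [4 D rho^n]. *)
Hypothesis sepW : {in W &, forall u v, u != v -> (4 * D + 2) * rho ^+ n <
  `|(PB x0 u - PB x0 v) * cos theta0 - (PA x0 u - PA x0 v) * sin theta0|}.
Hypothesis Wbig : 1 < (size W)%:R * (size ds)%:R ^+ n * rho ^+ n.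
Hypothesis near0 : {in `[alpha, beta], forall theta,
  4 * D * `|theta0 - theta| <= rho ^+ n}.
Hypothesis ab1 : beta - alpha <= 1.

Let kappa := rho ^+ n.
Let kappa0 : 0 < kappa. Proof. exact: exprn_gt0. Qed.
Let WW w : w \in W -> (size w == n) && all (mem ds2) w.
Proof. by move/WI; rewrite mem_words. Qed.

Let WPA y p : p \in W -> PA y p = kappa * y + PA 0 p.
Proof. by move=> /WW/andP[/eqP pn _]; rewrite /PA word_point_base pn. Qed.

Let WPB y p : p \in W -> PB y p = kappa * y + PB 0 p.
Proof. by move=> /WW/andP[/eqP pn _]; rewrite /PB word_point_base pn. Qed.

(** Of the margin [(4 * D + 2) * kappa] in [sepW], the base points use up [4 * D * kappa] and the
    passage from [theta0] to [theta] uses [kappa]; at least [kappa] remains. *)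
Let sep_first p p' theta y y' z z' : p \in W -> p' \in W -> p != p' ->
  theta \in `[alpha, beta] -> K y -> K y' -> K z -> K z' ->
  kappa <= `|(PB z p - PB z' p') * cos theta - (PA y p - PA y' p') * sin theta|.
Proof.
move=> pW pW' pp' th Ky Ky' Kz Kz'.
have /andP[_ aI] := WW pW. have /andP[_ aI'] := WW pW'.
set a := PA y p - PA y' p'; set b := PB z p - PB z' p'.
have hA : `|a| <= 2 * D by apply: K2D; exact: KPA.
have hB : `|b| <= 2 * D by apply: K2D; exact: KPB.
have := cos_sin_lipschitz a b theta0 theta.
have : (`|a| + `|b|) * `|theta0 - theta| <= kappa.
  by apply: le_trans (near0 th); rewrite ler_wpM2r//; lra.
have : `|kappa * ((z - z') * cos theta0 - (y - y') * sin theta0)| <= kappa * (4 * D).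
  rewrite normrM gtr0_norm// ler_pM2l// (le_trans (cos_sin_normB _ _ _))//.
  by have := K2D Ky Ky'; have := K2D Kz Kz'; lra.
have := sepW pW pW' pp'; rewrite -/kappa.
set U := (PB x0 p - _) * _ - _; set V := kappa * (_ - _).
have -> : b * cos theta0 - a * sin theta0 = U + V.
  by rewrite /U /V /a /b (WPA y)// (WPA y')// (WPA x0 pW) (WPA x0 pW')
    (WPB z)// (WPB z')// (WPB x0 pW) (WPB x0 pW'); ring.
have := ler_normB (U + V) V; rewrite addrK.
lra.
Qed.

Let I := [seq (p, q) | p <- W, q <- words ds n].
Let a (i : seq (R * R) * seq R) := PA 0 i.1.
Let b (i : seq (R * R) * seq R) := PB 0 i.1.
Let c (i : seq (R * R) * seq R) := PC 0 i.2.

Let IE p q : (p, q) \in I -> p \in W /\ q \in words ds n.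
Proof. by case/allpairsP => -[? ?] [/= h1 h2 [-> ->]]. Qed.

Let IK : {in I, forall i y, K y -> [/\ K (kappa * y + a i), K (kappa * y + b i) &
                               K (kappa * y + c i)]}.
Proof.
move=> [p q] /IE[pW qW] y Ky; have /andP[_ pI] := WW pW.
move: qW; rewrite mem_words => /andP[/eqP qn qI].
rewrite /a /b /c /= -WPA// -WPB// /kappa -qn -word_point_base.
by split; [exact: KPA|exact: KPB|exact: KPC].
Qed.

Let wp (d : seq (R * R) * seq R -> R) u := word_point kappa d x0 u.

Let Kwp u : all (mem I) u -> [/\ K (wp a u), K (wp b u) & K (wp c u)].
Proof.
by move=> uI; split; apply: (@word_point_mem _ _ I) => // i /IK h y /h[].
Qed.

(** Planar differences avoid a cone around the direction [(cos theta, sin theta)]. Equal planar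
    digits scale both sides by [kappa], so the estimate reduces to the first differing planar digit,
    where [sep_first] applies; if there is none, both sides vanish. *)
Let cone k u v theta : u \in words I k -> v \in words I k ->
  theta \in `[alpha, beta] ->
  kappa * (`|wp a u - wp a v| + `|wp b u - wp b v|) <= 4 * D *
    `|(wp b u - wp b v) * cos theta - (wp a u - wp a v) * sin theta|.
Proof.
move=> + + th; elim: k u v => [|k IH] u v.
  rewrite !inE => /eqP -> /eqP ->; rewrite /wp /= !subrr !mul0r subrr normr0.
  by rewrite addr0 !mulr0.
rewrite !mem_words; case: u v => [|[p q] u] [|[p' q'] v] //=.
rewrite !eqSS => /and3P[su iI uI] /and3P[sv jI vI].
have [aU bU cU] := Kwp uI. have [aV bV cV] := Kwp vI.
have [pW qW] := IE iI. have [pW' qW'] := IE jI.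
have -> : wp a ((p, q) :: u) - wp a ((p', q') :: v) = PA (wp a u) p - PA (wp a v) p'.
  by rewrite (WPA _ pW) (WPA _ pW').
have -> : wp b ((p, q) :: u) - wp b ((p', q') :: v) = PB (wp b u) p - PB (wp b v) p'.
  by rewrite (WPB _ pW) (WPB _ pW').
have [<-|pp'] := eqVneq p p'; last first.
  have := sep_first pW pW' pp' th aU aV bU bV; set g := `|_|.
  have /andP[_ pI] := WW pW; have /andP[_ pI'] := WW pW'.
  have : `|PA (wp a u) p - PA (wp a v) p'| <= 2 * D by apply: K2D; exact: KPA.
  have : `|PB (wp b u) p - PB (wp b v) p'| <= 2 * D by apply: K2D; exact: KPB.
  move=> hB hA hg; apply: (@le_trans _ _ (kappa * (4 * D))).
    by rewrite ler_pM2l//; lra.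
  by rewrite mulrC ler_wpM2l// mulr_ge0.
have := IH u v; rewrite !mem_words su sv => /(_ uI vI).
rewrite (WPA (wp a u) pW) (WPA (wp a v) pW) (WPB (wp b u) pW) (WPB (wp b v) pW).
have E x y z : kappa * x + z - (kappa * y + z) = kappa * (x - y) by ring.
have E2 x y z t : kappa * x * z - kappa * y * t = kappa * (x * z - y * t) by ring.
rewrite !E E2 !normrM (gtr0_norm kappa0) -mulrDr => h.
by rewrite [leRHS]mulrCA ler_pM2l.
Qed.

(** Transversality is checked in three cases, one for each summand of [C]. Distinct planar digits
    make the derivative at least [kappa]. Otherwise the third coordinates differ by at least [c1]: a
    planar difference of at most [c1 / 2] forces [eta >= c1 / 2], and a larger one has derivative at
    least [kappa2] by [cone]. *)
Lemma local_negligible : lebesgue_measure.-negligible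
  [set theta | theta \in `[alpha, beta] /\
     ~ (0 < lebesgue_measure (circle_sum K theta))%E].
Proof.
(* The bound from [cone] is [kappa * (c1 / 2) <= 4 * D * g]; the [+ 1] keeps the divisor positive
   when [D = 0]. *)
pose c1 := c0 * rho ^+ n; pose kappa2 := kappa * c1 / (2 * (4 * D + 1)).
have c10 : 0 < c1 by rewrite mulr_gt0.
have kappa20 : 0 < kappa2 by rewrite divr_gt0// ?mulr_gt0// ltr_wpDl// mulr_ge0.
pose C := 4 / kappa + 2 / c1 + 4 / kappa2.
have C0 : 0 <= C by rewrite /C !addr_ge0// divr_ge0// ltW.
apply: (@negligible_transversal_circle_sum R _ I a b c K kappa x0 alpha beta C) => //.
- apply: allpairs_uniq => //; first exact: words_uniq.
  by move=> [p q] [p' q'] /= _ _ [-> ->].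
- by rewrite kappa0 /kappa exprn_ilt1// -?lt0n// ltW.
- by rewrite size_allpairs size_words natrM natrX.
move=> k [p q] [p' q'] u v theta theta' eta iI jI ij uI vI th th' f hf hf'.
have [pW qW] := IE iI. have [pW' qW'] := IE jI.
have eta0 : 0 <= eta by exact: le_trans hf.
have [uA vA] : all (mem I) u /\ all (mem I) v.
  by move: uI vI; rewrite !mem_words => /andP[_ ?] /andP[_ ?].
have [aU bU cU] := Kwp uA. have [aV bV cV] := Kwp vA.
have th1 : `|theta - theta'| <= 1.
  move: th th'; rewrite !in_itv /= => /andP[h1 h2] /andP[h3 h4].
  by have := ab1; rewrite ler_norml => ?; apply/andP; split; lra.
have close kap : 0 < kap -> {in `[alpha, beta], forall z, kap <=
    `|(wp b ((p, q) :: u) - wp b ((p', q') :: v)) * cos z -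
      (wp a ((p, q) :: u) - wp a ((p', q') :: v)) * sin z|} ->
    `|theta - theta'| <= 4 / kap * eta.
  move=> kap0 hk; rewrite mulrAC ler_pdivlMr// mulrC.
  exact: (cos_sin_close hk th th' th1 (ltW kap0) hf hf').
have weaken x : 0 <= x <= C -> `|theta - theta'| <= x * eta ->
    `|theta - theta'| <= C * eta.
  by move=> /andP[_ xC] /le_trans; apply; rewrite ler_wpM2r.
have [P1 P2 P3] : [/\ 0 <= 4 / kappa, 0 <= 2 / c1 & 0 <= 4 / kappa2].
  by split; rewrite divr_ge0// ltW.
have [pp'|pp'] := eqVneq p p'; last first.
  apply: (weaken (4 / kappa)); first by rewrite /C; apply/andP; split; lra.
  apply: close => // z zI.
  have := sep_first pW pW' pp' zI aU aV bU bV.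
  by rewrite (WPA (wp a u) pW) (WPA (wp a v) pW') (WPB (wp b u) pW) (WPB (wp b v) pW').
have qq' : q != q' by apply: contra_neq ij => ->; rewrite pp'.
set dA := wp a ((p, q) :: u) - wp a ((p', q') :: v) in close.
set dB := wp b ((p, q) :: u) - wp b ((p', q') :: v) in close.
have hC : c1 <= `|wp c ((p, q) :: u) - wp c ((p', q') :: v)|.
  have := word_separation qW qW' qq' cU cV.
  rewrite /PC word_point_base [X in _ <= `|_ - X|]word_point_base.
  by move: qW qW'; rewrite !mem_words => /andP[/eqP -> _] /andP[/eqP -> _].
have [small|big] := leP (`|dA| + `|dB|) (c1 / 2).
  apply: (weaken (2 / c1)); first by rewrite /C; apply/andP; split; lra.
  apply: le_trans th1 _; rewrite mulrAC ler_pdivlMr// mul1r.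
  have := cos_sin_norm dA dB theta; move: hf hC; rewrite /f -/(wp _ _) -/dA -/dB.
  set g := dA * _ + _; set e := _ - _ => hf hC hg.
  have : `|e| <= `|g + e| + `|g|.
    by rewrite -[X in `|X| <= _](addKr g) addrC (le_trans (ler_normD _ _))// normrN.
  lra.
apply: (weaken (4 / kappa2)); first by rewrite /C; apply/andP; split; lra.
apply: close => // z zI; rewrite -/dA -/dB.
have kI : forall i w, i \in I -> w \in words I k -> i :: w \in words I k.+1.
  by move=> i w iI'; rewrite !mem_words /= eqSS iI'.
have := cone (kI _ _ iI uI) (kI _ _ jI vI) zI; rewrite -/dA -/dB.
set g := `|dB * _ - _| => hg; have g0 : 0 <= g by exact: normr_ge0.
rewrite /kappa2 ler_pdivrMr; last by rewrite mulr_gt0// ltr_wpDl// mulr_ge0.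
have : kappa * (c1 / 2) <= kappa * (`|dA| + `|dB|) by rewrite ler_pM2l// ltW.
lra.
Qed.
End Local.

(** * Almost every angle *)

Let M : R := (size ds)%:R.
Hypotheses (M3rho : 1 < M ^+ 3 * rho) (M2rho : M ^+ 2 * rho < 1).

Let separated_digits theta := exists (n : nat) (W : seq (seq (R * R))),
  [/\ (0 < n)%N, uniq W, {subset W <= words ds2 n},
    {in W &, forall u v, u != v -> (4 * D + 2) * rho ^+ n <
      `|(PB x0 u - PB x0 v) * cos theta - (PA x0 u - PA x0 v) * sin theta|} &
    1 < (size W)%:R * M ^+ n * rho ^+ n].

(** The projections of the planar system are transversal by [cos_sin_rotation_close], since pairs
    with distinct first digits differ by at least [c0] in some coordinate. As [M ^+ 2 * rho < 1],
    the expected number of close pairs is at most a constant [H] times the number of words. *)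
Let ae_separated_digits : lebesgue_measure.-negligible
  [set theta : R | theta \in `[0, 1] /\ ~ separated_digits theta].
Proof.
have M0 : 0 < M.
  rewrite lt_neqAle ler0n andbT; apply: contraTneq M3rho => <-.
  by rewrite expr0n /= mul0r ltr10.
pose F (t : R * R) theta := t.2 * cos theta - t.1 * sin theta.
pose F0 theta := x0 * cos theta - x0 * sin theta.
pose X w theta := word_point rho (F ^~ theta) (F0 theta) w.
have XE w theta : X w theta = PB x0 w * cos theta - PA x0 w * sin theta.
  rewrite /X /F /F0 /PA /PB; elim: w => //= t w ->; ring.
have mF (p q : R) : measurable_fun setT (fun th => p * cos th - q * sin th).
  apply: measurable_funB.
    by apply: measurable_funM => //; apply: continuous_measurable_fun; exact: continuous_cos.
  by apply: measurable_funM => //; apply: continuous_measurable_fun; exact: continuous_sin.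
have uI : uniq ds2 by apply: allpairs_uniq => // -[? ?] [? ?].
have C0 : 0 <= 8 / c0 by rewrite divr_ge0// ltW.
have L0 : 0 <= 4 * D + 2 by rewrite addr_ge0// mulr_ge0.
have transX k i j u v (th th' eta : R) : i \in ds2 -> j \in ds2 -> i != j ->
    u \in words ds2 k -> v \in words ds2 k ->
    th \in `[0, 1] -> th' \in `[0, 1] ->
    `|X (i :: u) th - X (j :: v) th| <= eta ->
    `|X (i :: u) th' - X (j :: v) th'| <= eta -> `|th - th'| <= 8 / c0 * eta.
  rewrite !mem_words => iI jI ij /andP[_ uI'] /andP[_ vI] thI thI'.
  set a := PA x0 (i :: u) - PA x0 (j :: v).
  set b := PB x0 (i :: u) - PB x0 (j :: v).
  have E z : X (i :: u) z - X (j :: v) z = b * cos z - a * sin z.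
    by rewrite !XE /a /b; ring.
  rewrite !E => h h'; have th1 : `|th - th'| <= 1.
    move: thI thI'; rewrite !in_itv /= => /andP[h1 h2] /andP[h3 h4].
    by rewrite ler_norml; apply/andP; split; lra.
  rewrite mulrAC ler_pdivlMr// mulrC.
  apply: le_trans (cos_sin_rotation_close th1 h h').
  rewrite ler_wpM2r//.
  case/allpairsP: (iI) => -[s t] [/= sI tI iE].
  case/allpairsP: (jI) => -[s' t'] [/= sI' tI' jE].
  have [ss'|ss'] := eqVneq s s'.
    have tt' : t != t' by apply: contra_neq ij => tt; rewrite iE jE ss' tt.
    have : c0 <= `|b| by rewrite /b iE jE /=; apply: dsep => //; exact: KPB.
    by move=> hb; have := normr_ge0 a; lra.
  have : c0 <= `|a| by rewrite /a iE jE /=; apply: dsep => //; exact: KPA.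
  by move=> ha; have := normr_ge0 b; lra.
have ab1 : 1 - 0 <= 1 :> R by rewrite subr0.
have sepw k := separated_words uI rho0 C0 L0 ab1 (fun t => mF t.2 t.1)
  (mF x0 x0) transX k.
have NE : (size ds2)%:R = M ^+ 2 :> R by rewrite size_allpairs natrM expr2.
rewrite NE in sepw.
pose H := 1 + 2 * (8 / c0) * (4 * D + 2) * (1 - M ^+ 2 * rho)^-1.
have CL0 : 0 <= 2 * (8 / c0) * (4 * D + 2) by rewrite mulr_ge0// mulr_ge0.
have H0 : 0 < H.
  by rewrite ltr_pwDl// mulr_ge0// invr_ge0 subr_ge0 ltW.
apply: negligible_small => e e0.
(* With the threshold [(M ^+ 2) ^+ n * H / e], Markov's inequality gives an exceptional set of
   measure at most [e]; off it [size W] is at least [(M ^+ 2) ^+ n * e / (4 * H)]. This [n] makes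
   the resulting [(M ^+ 3 * rho) ^+ n * e / (4 * H)] exceed 1. *)
have [n n0 hn] : exists2 n, (0 < n)%N & 4 * H / e < (M ^+ 3 * rho) ^+ n.
  have x01 : 0 < (M ^+ 3 * rho)^-1 < 1.
    by have q0 := lt_trans ltr01 M3rho; rewrite invr_gt0 q0 invf_lt1.
  have r0 : 0 < e / (4 * H) by rewrite divr_gt0// mulr_gt0.
  have [n hn] := exprn_eventually_lt x01 r0.
  exists n.+1 => //; have := hn n.+1 (leqnSn n).
  rewrite exprVn -[ltRHS]invrK ltf_pV2 ?posrE ?invr_gt0//; last first.
    by rewrite exprn_gt0// (lt_trans _ M3rho).
  by rewrite invf_div.
have nu0 : 0 < (M ^+ 2) ^+ n * H / e by rewrite divr_gt0// mulr_gt0// !exprn_gt0.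
have [B [mB muB BW]] := sepw n _ (ltW nu0).
exists B; split => //.
  move=> theta /= [thI nsep]; apply: contrapT => nB; apply: nsep.
  have [W [WI uW' sW tW]] := BW theta thI nB.
  exists n, W; split => //.
    move=> u v uI' vI uv; have := sW u v uI' vI uv; rewrite -/(X u _) -/(X v _) !XE.
    by congr (_ < `|_|); ring.
  rewrite -(ltr_pM2l (mulr_gt0 (ltr0n _ 4) H0)) mulr1.
  move: hn; rewrite ltr_pdivrMr// => /lt_le_trans; apply.
  have N0 : 0 < (M ^+ 2) ^+ n by rewrite !exprn_gt0.
  have {}tW : (M ^+ 2) ^+ n * e <= 4 * (size W)%:R * H.
    rewrite -(ler_pM2l N0) mulrA -exprD addnn -mul2n -ler_pdivlMr//.
    by apply: le_trans tW _; rewrite le_eqVlt; apply/orP; left; apply/eqP; field; rewrite gt_eqF.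
  have P0 : 0 <= M ^+ n * rho ^+ n by rewrite mulr_ge0// exprn_ge0// ltW.
  have := ler_wpM2r P0 tW.
  rewrite (_ : (M ^+ 2) ^+ n * e * _ = (M ^+ 3 * rho) ^+ n * e); last first.
    have E3 : (M ^+ 3) ^+ n = (M ^+ 2) ^+ n * M ^+ n.
      by rewrite -(exprM M 3) -(exprM M 2) -exprD -[in RHS]mulSnr.
    by rewrite [(M ^+ 3 * rho) ^+ n]exprMn E3; ring.
  rewrite (_ : 4 * (size W)%:R * H * _ = 4 * H * ((size W)%:R * M ^+ n * rho ^+ n)) //.
  by ring.
suff : (((M ^+ 2) ^+ n * H / e)%:E * lebesgue_measure B <=
    ((M ^+ 2) ^+ n * H / e)%:E * e%:E)%E by rewrite lee_pmul2l ?lte_fin.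
apply: le_trans muB _; rewrite -EFinM lee_fin divfK ?gt_eqF//.
rewrite ler_pM2l ?exprn_gt0// /H lerD2l ler_wpM2l//.
by apply: geometric_sum_lt1; rewrite M2rho andbT mulr_ge0 ?exprn_ge0// ltW.
Qed.

(** [local_negligible] treats an interval around each good angle, and there are uncountably many of
    these. Grid intervals [[j / (m + 1), (j + 1) / (m + 1)]] reduce them to a countable family. *)
Lemma ae_circle_sum : lebesgue_measure.-negligible
  [set theta : R | theta \in `[0, 1] /\
     ~ (0 < lebesgue_measure (circle_sum K theta))%E].
Proof.
pose bad (theta : R) := ~ (0 < lebesgue_measure (circle_sum K theta))%E.
pose J m j : set R := [set theta | theta \in `[j%:R / m.+1%:R, j.+1%:R / m.+1%:R] /\ bad theta].
(* Grid intervals whose bad part is not negligible are discarded, so the union is negligible by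
   construction and only covering is left to prove. *)
pose F m j := if `[< lebesgue_measure.-negligible (J m j) >] then J m j else set0.
have : lebesgue_measure.-negligible
    ([set theta | theta \in `[0, 1] /\ ~ separated_digits theta] `|`
     \bigcup_m \bigcup_j F m j).
  apply: negligibleU => //; do 2!(apply: negligible_bigcup => ?).
  by rewrite /F; case: asboolP => // _; exact: negligible_set0.
apply: negligibleS => theta /= [thI hbad].
have [sep|nsep] := pselect (separated_digits theta); last by left.
right; have [n [W [n0 uW WI sW bW]]] := sep.
have [m hm] : exists m : nat, 4 * D / m.+1%:R <= rho ^+ n.
  exists (Num.trunc (4 * D / rho ^+ n)).
  rewrite ler_pdivrMr// [leRHS]mulrC -ler_pdivrMr ?exprn_gt0// ltW//.
  exact: truncnS_gt.
have th0 : 0 <= theta * m.+1%:R.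
  by move: thI; rewrite in_itv /= => /andP[? _]; rewrite mulr_ge0.
pose j := Num.trunc (theta * m.+1%:R).
have thJ : theta \in `[j%:R / m.+1%:R, j.+1%:R / m.+1%:R].
  have := truncn_itv th0; rewrite -/j => /andP[jl jr].
  by rewrite in_itv /= ler_pdivrMr// ler_pdivlMr// jl ltW.
exists m => //; exists j => //; rewrite /F; case: asboolP => //; case.
have len : j.+1%:R / m.+1%:R - j%:R / m.+1%:R = m.+1%:R^-1 :> R.
  by rewrite -mulrBl -natrB// subSnn mul1r.
apply: (local_negligible n0 uW WI sW bW).
  move=> z zJ; apply: le_trans hm; rewrite ler_wpM2l ?mulr_ge0// -len.
  move: thJ zJ; rewrite !in_itv /=; move: (_ / _) (_ / _) => hi lo.
  by move=> /andP[h1 h2] /andP[h3 h4]; rewrite ler_norml; apply/andP; split; lra.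
by rewrite len invf_le1// ler1n.
Qed.
End HomogeneousSystem.

(** * Hausdorff dimension and coverings *)

Section HausdorffDimensionBounds.
Context {R : realType}.
Implicit Types (A U : set R) (s t delta : R).

Lemma diam_le U (d : R) : 0 <= d -> (forall x y, U x -> U y -> `|x - y| <= d) ->
  (diam U <= d%:E)%E.
Proof.
move=> d0 Ud; rewrite /diam ge_max lee_fin d0 /=.
by apply: ge_ereal_sup => _ [x Ux [y Uy <-]]; rewrite lee_fin Ud.
Qed.

Lemma diam_pow_le s U (d : R) : 0 <= s -> 0 <= d ->
  (forall x y, U x -> U y -> `|x - y| <= d) -> (diam_pow s U <= (d `^ s)%:E)%E.
Proof.
move=> s0 d0 Ud; rewrite /diam_pow; case: ifP => _; first by rewrite lee_fin powR_ge0.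
rewrite -poweR_EFin; apply: gt0_ler_poweR => //.
- by rewrite in_itv /= leey andbT /diam le_max lexx.
- by rewrite in_itv /= leey andbT lee_fin.
- exact: diam_le.
Qed.

Lemma diam_pow_ge0 s U : (0 <= diam_pow s U)%E.
Proof. by rewrite /diam_pow; case: ifP => // _; exact: poweR_ge0. Qed.

Lemma hausdorff_premeasure_ge0 s delta A : (0 <= hausdorff_premeasure s delta A)%E.
Proof.
apply: le_ereal_inf_tmp => _ [U _ <-]; apply: nneseries_ge0 => n _ _.
exact: diam_pow_ge0.
Qed.

Lemma hausdorff_premeasure_le s delta A (cs : seq R) (e : R) :
  0 <= s -> 0 <= e -> 2 * e <= delta ->
  (forall x, A x -> exists2 c, c \in cs & `|x - c| <= e) ->
  (hausdorff_premeasure s delta A <= ((size cs)%:R * (2 * e) `^ s)%:E)%E.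
Proof.
move=> s0 e0 ed cov.
(* The finite cover is padded with empty sets, which contribute 0 to the series even when
   [s = 0]. *)
pose U i : set R := if (i < size cs)%N then [set x | `|x - nth 0 cs i| <= e] else set0.
have Ue i x y : U i x -> U i y -> `|x - y| <= 2 * e.
  rewrite /U; case: ifP => // _ /= hx hy.
  rewrite (_ : x - y = (x - nth 0 cs i) - (y - nth 0 cs i)); last by ring.
  by rewrite (le_trans (ler_normB _ _))// mulr_natl mulr2n lerD.
have e20 : 0 <= 2 * e by rewrite mulr_ge0.
apply: (@le_trans _ _ (\sum_(0 <= i <oo) diam_pow s (U i))%E).
  apply: ereal_inf_lbound; exists U => //; split.
    move=> x /cov[c ccs xc]; exists (index c cs) => //.
    by rewrite /U index_mem ccs /= nth_index.
  by move=> i; apply: le_trans (diam_le e20 (Ue i)) _; rewrite lee_fin.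
rewrite (@nneseries_split _ _ 0 (size cs)); last by move=> *; exact: diam_pow_ge0.
rewrite add0n [X in (_ + X)%E]eseries0 ?adde0; last first.
  by move=> i ni _; rewrite /U ltnNge ni /= /diam_pow eqxx.
apply: (@le_trans _ _ (\sum_(0 <= i < size cs) ((2 * e) `^ s)%:E)%E).
  by apply: lee_sum => i _; apply: diam_pow_le => //; exact: Ue.
by rewrite sumEFin lee_fin sum_const_seq size_iota subn0.
Qed.

(** For [s] strictly between [t] and the dimension the [s]-measure is nonzero, as otherwise [s]
    would bound the dimension from above. So some premeasure exceeds a real [c > 0], and it is
    tested on covers by intervals of equal length. *)
Lemma hausdorff_dim_covering A t : 0 <= t -> (t%:E < hausdorff_dim A)%E ->
  exists s c delta, [/\ t < s, 0 < c, 0 < delta &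
    forall (cs : seq R) (e : R), 0 <= e -> 2 * e <= delta ->
      (forall x, A x -> exists2 c, c \in cs & `|x - c| <= e) ->
      c <= (size cs)%:R * (2 * e) `^ s].
Proof.
move=> t0 tA; have [s ts sA] : exists2 s, t < s & (s%:E < hausdorff_dim A)%E.
  move: tA; case: (hausdorff_dim A) => [d| |] //.
    by rewrite lte_fin => td; exists ((t + d) / 2); rewrite ?lte_fin; lra.
  by move=> _; exists (t + 1); rewrite ?ltry// ltrDl.
have s0 : 0 <= s by rewrite (le_trans t0)// ltW.
have mA0 : (0 < hausdorff_measure s A)%E.
  rewrite lt_neqAle; apply/andP; split; last first.
    apply: (@le_trans _ _ (hausdorff_premeasure s 1 A)).
      exact: hausdorff_premeasure_ge0.
    by apply: ereal_sup_ubound; exists 1 => //=; exact: ltr01.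
  apply/eqP => mA; move: sA; rewrite ltNge => /negP; apply.
  by apply: ereal_inf_lbound; exists s => //; split.
have [_ [delta /= d0 <-] pA] := ereal_sup_gt mA0.
have [c c0 cA] : exists2 c, 0 < c & (c%:E <= hausdorff_premeasure s delta A)%E.
  move: pA; case: (hausdorff_premeasure s delta A) => [c| |] //.
    by rewrite lte_fin => c0; exists c.
  by move=> _; exists 1; rewrite ?leey.
exists s, c, delta; split=> // cs e e0 ed cov; rewrite -lee_fin.
by apply: le_trans cA _; exact: hausdorff_premeasure_le.
Qed.
End HausdorffDimensionBounds.

(** * Reduction to systems without reflections *)

Section SelfSimilarSubsystems.
Context {R : realType}.

(** Polarization of the squared distances gives [(f x - f 0) * (f 1 - f 0) = rho ^+ 2 * x], and
    [f 1 - f 0] is [rho] or [- rho]. *)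
Lemma similitude_affine (rho : R) (f : R -> R) : 0 < rho ->
  (forall x y, `|f x - f y| = rho * `|x - y|) ->
  (forall x, f x = rho * x + f 0) \/ (forall x, f x = - rho * x + f 0).
Proof.
move=> rho0 fE.
have sq x y : (f x - f y) ^+ 2 = rho ^+ 2 * (x - y) ^+ 2.
  by rewrite -[LHS]real_normK ?num_real// fE exprMn real_normK ?num_real.
have : (f 1 - f 0 - rho) * (f 1 - f 0 + rho) = 0.
  by have := sq 1 0; rewrite subr0 expr1n mulr1 => h; rewrite -subr_sqr h subrr.
have lin x : (f x - f 0) * (f 1 - f 0) = rho ^+ 2 * x.
  have h0 := sq x 0; have h1 := sq x 1; have h2 := sq 1 0.
  have : 2 * ((f x - f 0) * (f 1 - f 0)) = 2 * (rho ^+ 2 * x).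
    rewrite (_ : 2 * ((f x - f 0) * (f 1 - f 0)) =
      (f x - f 0) ^+ 2 + (f 1 - f 0) ^+ 2 - (f x - f 1) ^+ 2); last by ring.
    by rewrite h0 h1 h2; ring.
  by move/mulfI; apply; rewrite pnatr_eq0.
move/eqP; rewrite mulf_eq0 => /orP[|] /eqP f1; [left|right] => x.
  have E : f 1 - f 0 = rho by apply/eqP; rewrite -subr_eq0 f1.
  have := lin x; rewrite E => h; apply/eqP; rewrite -subr_eq; apply/eqP.
  by apply: (@mulIf _ rho); rewrite ?gt_eqF// h; ring.
have E : f 1 - f 0 = - rho by apply/eqP; rewrite -addr_eq0 f1.
have := lin x; rewrite E => h; apply/eqP; rewrite -subr_eq; apply/eqP.
by apply: (@mulIf _ (- rho)); rewrite ?oppr_eq0 ?gt_eqF// h; ring.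
Qed.

Variables (K : set R) (q : nat) (psi : 'I_q -> R -> R) (r x0 : R).
Hypotheses (r01 : 0 < r < 1) (psiE : forall i x y, `|psi i x - psi i y| = r * `|x - y|).
Hypotheses (Kpsi : K = \bigcup_(i in [set: 'I_q]) (psi i @` K)).
Hypothesis Kx0 : K x0.

Let r0 : 0 < r. Proof. by case/andP: r01. Qed.
Let letters := enum 'I_q.

Definition word_map (w : seq 'I_q) (x : R) : R := foldr psi x w.

Lemma word_map_dist w x y : `|word_map w x - word_map w y| = r ^+ size w * `|x - y|.
Proof. by elim: w => [|i w IH] /=; rewrite ?mul1r// psiE IH exprS mulrA. Qed.

Lemma word_map_mem w x : K x -> K (word_map w x).
Proof. by move=> Kx; elim: w => //= i w IH; rewrite Kpsi; exists i => //; exists (word_map w x). Qed.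

Lemma word_map_cover n x : K x ->
  exists w y, [/\ w \in words letters n, K y & x = word_map w y].
Proof.
elim: n x => [|n IH] x Kx; first by exists [::], x.
move: (Kx); rewrite {1}Kpsi => -[i _ [y Ky <-]].
have [w [z [wI Kz ->]]] := IH _ Ky.
exists (i :: w), z; split=> //; move: wI; rewrite !mem_words /= eqSS => /andP[-> ->].
by rewrite mem_enum.
Qed.

(** A maximal family of words whose images of [x0] are more than [(4 * D + 1) * r ^+ n] apart. Every
    point of a piece is within [2 * D * r ^+ n] of the image of [x0]: subtracting this twice leaves
    [r ^+ n], and adding it once gives the covering radius. *)
Lemma separated_pieces (D : R) n : (forall x, K x -> `|x| <= D) -> 0 <= D ->
  exists W : seq (seq 'I_q),
  [/\ uniq W, {in W, forall w, size w = n},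
    {in W &, forall u v, u != v -> forall y z, K y -> K z ->
      r ^+ n <= `|word_map u y - word_map v z|} &
    forall x, K x -> exists2 c, c \in [seq word_map w x0 | w <- W] &
      `|x - c| <= (6 * D + 1) * r ^+ n].
Proof.
move=> KD D0; have K2D y y' : K y -> K y' -> `|y - y'| <= 2 * D.
  move=> /KD h /KD h'; rewrite (le_trans (ler_normB _ _))//.
  by rewrite mulr_natl mulr2n lerD.
have rn0 : 0 < r ^+ n by rewrite exprn_gt0.
pose rel (u v : seq 'I_q) :=
  `|word_map u x0 - word_map v x0| <= (4 * D + 1) * r ^+ n.
have rr : reflexive rel.
  by move=> u; rewrite /rel subrr normr0 mulr_ge0 ?addr_ge0 ?mulr_ge0// ltW.
have rs : symmetric rel by move=> u v; rewrite /rel distrC.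
have [W [WI uW sW dW]] := maximal_independent (words letters n) rr rs.
have sz : {in W, forall w, size w = n}.
  by move=> w /WI; rewrite mem_words => /andP[/eqP].
exists W; split=> //.
  move=> u v uI vI uv y z Ky Kz; have := sW u v uI vI uv; rewrite /rel -ltNge.
  have h1 := word_map_dist u y x0; have h2 := word_map_dist v z x0.
  move: h1 h2; rewrite !sz// => h1 h2.
  have k1 := K2D _ _ Ky Kx0; have k2 := K2D _ _ Kz Kx0.
  have {}h1 : `|word_map u y - word_map u x0| <= r ^+ n * (2 * D).
    by rewrite h1 ler_pM2l.
  have {}h2 : `|word_map v z - word_map v x0| <= r ^+ n * (2 * D).
    by rewrite h2 ler_pM2l.
  rewrite (_ : word_map u x0 - word_map v x0 = (word_map u y - word_map v z) -
    (word_map u y - word_map u x0) + (word_map v z - word_map v x0)); last by ring.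
  move=> h; have := ler_normD ((word_map u y - word_map v z) -
    (word_map u y - word_map u x0)) (word_map v z - word_map v x0).
  have := ler_normB (word_map u y - word_map v z) (word_map u y - word_map u x0).
  lra.
move=> x /(word_map_cover n)[v [y [vI Ky ->]]].
have /hasP[w wW rvw] := dW v vI.
exists (word_map w x0); first by apply/mapP; exists w.
have vn : size v = n by move: vI; rewrite mem_words => /andP[/eqP].
have : `|word_map v y - word_map v x0| <= r ^+ n * (2 * D).
  by rewrite word_map_dist vn ler_pM2l// K2D.
have := ler_distD (word_map v x0) (word_map v y) (word_map w x0).
move: rvw; rewrite /rel; lra.
Qed.

(** Each word map has slope [r ^+ n] or [- r ^+ n]; a sign shared by at least half of the words is
    kept. *)
Lemma oriented_pieces n (W : seq (seq 'I_q)) :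
  {in W, forall w, size w = n} -> uniq W -> exists (V : seq (seq 'I_q)) (sigma : R),
  [/\ sigma ^+ 2 = 1, {subset V <= W}, uniq V, (size W <= 2 * size V)%N &
    {in V, forall w x, word_map w x = sigma * r ^+ n * x + word_map w 0}].
Proof.
move=> sz uW; pose b w := `[< forall x, word_map w x = r ^+ n * x + word_map w 0 >].
have nb w : w \in W -> ~~ b w ->
    forall x, word_map w x = - 1 * r ^+ n * x + word_map w 0.
  move=> wW /asboolPn nb; have rn0 : 0 < r ^+ n by rewrite exprn_gt0.
  have [|//|h x] := similitude_affine rn0 (f := word_map w).
    by move=> x y; rewrite word_map_dist sz.
  by rewrite mulN1r.
have szW := count_predC b W.
have [le|lt] := leqP (size W) (2 * count b W).
  exists [seq w <- W | b w], 1; split; rewrite ?expr1n ?filter_uniq ?size_filter//.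
    by move=> w; rewrite mem_filter => /andP[].
  by move=> w; rewrite mem_filter => /andP[/asboolP bw _] x; rewrite bw mul1r.
exists [seq w <- W | predC b w], (-1); split; rewrite ?sqrrN ?expr1n ?filter_uniq//.
- by move=> w; rewrite mem_filter => /andP[].
- by rewrite size_filter -(leq_add2l (2 * count b W)) -mulnDr szW [leqRHS]mul2n -addnn leq_add2r ltnW.
- by move=> w; rewrite mem_filter => /andP[/= bw wW] x; exact: nb.
Qed.

(* Composing two pieces of the same orientation cancels the reflections, at the
   cost of squaring the ratio.  The bound [27 rho <= 1] makes the least m with
   [1 < m^3 rho] at least 4, so that [m^2 < (m - 1)^3 <= 1 / rho]. *)
Lemma homogeneous_subsystem n (W : seq (seq 'I_q)) :
  {in W, forall w, size w = n} -> uniq W ->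
  {in W &, forall u v, u != v -> forall y z, K y -> K z ->
      r ^+ n <= `|word_map u y - word_map v z|} ->
  27 * (r ^+ n) ^+ 2 <= 1 -> 8 < (size W)%:R ^+ 3 * r ^+ n ->
  exists ds : seq R, let rho := (r ^+ n) ^+ 2 in
    [/\ uniq ds, {in ds, forall t y, K y -> K (rho * y + t)},
      {in ds &, forall t t', t != t' -> forall y y', K y -> K y' ->
        rho <= `|rho * y + t - (rho * y' + t')|},
      1 < (size ds)%:R ^+ 3 * rho & (size ds)%:R ^+ 2 * rho < 1].
Proof.
move=> sz uW sep small big.
have [V [sigma [s2 VW uV WV aff]]] := oriented_pieces sz uW.
set x := r ^+ n in sep small big aff *; set rho := x ^+ 2.
have x_gt0 : 0 < x by rewrite exprn_gt0.
have rho0 : 0 < rho by rewrite exprn_gt0.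
have x1 : x <= 1 by rewrite exprn_ile1// ltW//; case/andP: r01.
pose P := [seq (u, v) | u <- V, v <- V].
pose t (p : seq 'I_q * seq 'I_q) := word_map p.1 (word_map p.2 0).
have PV p : p \in P -> p.1 \in V /\ p.2 \in V.
  by case/allpairsP => -[u v] [/= h1 h2 ->].
have tE p y : p \in P -> rho * y + t p = word_map p.1 (word_map p.2 y).
  move=> /PV[h1 h2]; rewrite /t (aff p.1 h1 (word_map p.2 0)) (aff p.1 h1 (word_map p.2 y)) (aff p.2 h2 y).
  by rewrite /rho -[x ^+ 2]mul1r -s2; ring.
have tsep p p' y y' : p \in P -> p' \in P -> p != p' -> K y -> K y' ->
    rho <= `|rho * y + t p - (rho * y' + t p')|.
  move=> pP pP' pp' Ky Ky'; rewrite !tE//.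
  have [h1 h2] := PV _ pP; have [h1' h2'] := PV _ pP'.
  have [e|ne] := eqVneq p.1 p'.1; last first.
    apply: (@le_trans _ _ x); first by rewrite /rho expr2 ler_piMl// ltW.
    by apply: sep; rewrite ?VW//; exact: word_map_mem.
  have ne : p.2 != p'.2.
    by apply: contra_neq pp'; move: p p' e {pP pP' h1 h2 h1' h2'} => [? ?] [? ?] /= -> ->.
  rewrite e word_map_dist (sz _ (VW _ h1')) /rho expr2 ler_pM2l//.
  by apply: sep; rewrite ?VW.
have tinj : {in P &, injective t}.
  move=> p p' pP pP' tt; apply/eqP; apply: contraT => pp'.
  by have := tsep p p' x0 x0 pP pP' pp' Kx0 Kx0; rewrite tt subrr normr0 leNgt rho0.
have uP : uniq P by apply: allpairs_uniq => // -[? ?] [? ?].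
have szP : size P = (size V ^ 2)%N by rewrite size_allpairs mulnn.
have bigP : 1 < (size P)%:R ^+ 3 * rho.
  (* Passing from [W] to [V] costs at most [2 ^ 3 = 8]. Squaring the bound then gives the one for
     pairs, whose number is [size V ^ 2] and whose ratio is [x ^+ 2]. *)
  have : 1 < (size V)%:R ^+ 3 * x.
    have h : (size W)%:R ^+ 3 <= (2 * size V)%:R ^+ 3 :> R.
      by rewrite lerXn2r ?nnegrE ?ler_nat.
    have := ler_wpM2r (ltW x_gt0) h; rewrite natrM exprMn.
    set a := (size V)%:R ^+ 3; set b := (size W)%:R ^+ 3 in big *.
    by clearbody a b; move=> h'; lra.
  move=> h; rewrite szP natrX exprAC /rho -exprMn.
  by rewrite expr2 (lt_trans h)// ltr_pMl// (lt_trans ltr01).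
have exM : exists m, 1 < (m%:R : R) ^+ 3 * rho by exists (size P).
have [m hm mmin] := ex_minnP exM.
have mP : (m <= size P)%N by exact: mmin.
have m4 : (4 <= m)%N.
  rewrite leqNgt; apply/negP => m3; move: hm; rewrite ltNge => /negP; apply.
  have : (m%:R : R) ^+ 3 <= 3%:R ^+ 3 by rewrite lerXn2r ?nnegrE ?ler_nat.
  move=> /(ler_wpM2r (ltW rho0)) /le_trans; apply.
  by apply: le_trans small; rewrite /rho; lra.
have mrho : m%:R ^+ 2 * rho < 1.
  have pm : m.-1%:R ^+ 3 * rho <= 1.
    by rewrite leNgt; apply/negP => /mmin; lia.
  apply: lt_le_trans pm; rewrite ltr_pM2r// -!natrX ltr_nat.
  by case: m m4 {hm mmin mP} => // m' /=; rewrite !expnS expn0; nia.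
exists (take m (map t P)); rewrite /= size_takel ?size_map//; split=> //.
- by rewrite take_uniq// map_inj_in_uniq.
- move=> _ /mem_take/mapP[p pP ->] y Ky; rewrite tE//.
  by apply: word_map_mem; exact: word_map_mem.
- move=> _ _ /mem_take/mapP[p pP ->] /mem_take/mapP[p' pP' ->] tt y y' Ky Ky'.
  by apply: tsep => //; apply: contra_neq tt => ->.
Qed.
End SelfSimilarSubsystems.

(** * Choice of the level and conclusion *)

Theorem corollary1p10 (R : realType) (K : set R)
    (K_self_similar : equicontractive_self_similar K)
    (dimK : ((1 / 3 : R)%:E < hausdorff_dim K)%E) :
  {ae (@lebesgue_measure R), forall theta : R, theta \in `[0, 1] ->
    (0 < lebesgue_measure
           (add_set (add_set (scale_set (cos theta) K)
                             (scale_set (sin theta) K)) K))%E}.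
Proof.
have [q [psi [r [psiS [[x0 Kx0] cK KE]]]]] := K_self_similar.
have [i0 _ _] : (\bigcup_(i in [set: 'I_q]) (psi i @` K)) x0.
  by move: Kx0; rewrite {1}KE.
have [r01 _] := psiS i0.
have psiE i x y : `|psi i x - psi i y| = r * `|x - y| by have [_ ->] := psiS i.
have [D D0 KD] : exists2 D, 0 <= D & forall x, K x -> `|x| <= D.
  have [B [_ HB]] := compact_bounded cK.
  exists (`|B| + 1); first by rewrite addr_ge0.
  by move=> x Kx; apply: (HB (`|B| + 1)) => //; rewrite (le_lt_trans (ler_norm _))// ltrDl.
have t0 : 0 <= 1 / 3 :> R by rewrite divr_ge0.
have [s [c [delta [s13 c0 d0 cov]]]] := hausdorff_dim_covering t0 dimK.
(* [E * r ^+ n] is the length of the covering intervals given by [separated_pieces]. *)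
pose E := 2 * (6 * D + 1).
have E0 : 0 < E by rewrite mulr_gt0// ltr_wpDl// mulr_ge0.
pose a := 3 * s - 1; have a0 : 0 < a by rewrite /a; lra.
(* With [x = r ^+ n * E], cubing the covering bound gives [c ^+ 3 <= N ^+ 3 * r ^+ n * E * x ^ a].
   Once [x ^ a <= eta], this yields [N ^+ 3 * r ^+ n >= 9 > 8]. *)
pose eta := c ^+ 3 / (9 * E).
have eta0 : 0 < eta by rewrite divr_gt0 ?exprn_gt0// mulr_gt0.
(* The three thresholds give, in order, [27 * (r ^+ n) ^+ 2 <= 1], covers of diameter at most
   [delta], and [x ^ a <= eta]. *)
pose m := Num.min (27^-1) (Num.min (delta / E) (eta `^ a^-1 / E)).
have m0 : 0 < m.
  rewrite !lt_min; apply/and3P; split; [|exact: divr_gt0|].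
    by rewrite invr_gt0.
  by rewrite divr_gt0// powR_gt0.
have [n hn] := exprn_eventually_lt r01 m0.
have {hn} := hn n (leqnn n); rewrite !lt_min !ltr_pdivlMr// => /and3P[rn1 rn2 rn3].
have rn0 : 0 < r ^+ n by rewrite exprn_gt0//; case/andP: r01.
have [W [uW sz sep Wcov]] := separated_pieces r01 psiE KE Kx0 n KD D0.
have e0 : 0 <= (6 * D + 1) * r ^+ n.
  by rewrite mulr_ge0 ?addr_ge0 ?mulr_ge0// ltW.
have ed : 2 * ((6 * D + 1) * r ^+ n) <= delta by rewrite mulrA -/E mulrC ltW.
have := cov _ _ e0 ed Wcov; rewrite size_map mulrA -/E [E * _]mulrC.
set x := r ^+ n * E in rn2 rn3 *; have x0' : 0 < x by rewrite mulr_gt0.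
set N : R := (size W)%:R => cN.
have big : 8 < N ^+ 3 * r ^+ n.
  have : c ^+ 3 <= (N * x `^ s) ^+ 3.
    by rewrite lerXn2r// nnegrE; [exact: ltW|rewrite mulr_ge0 ?powR_ge0].
  have -> : (N * x `^ s) ^+ 3 = N ^+ 3 * r ^+ n * (E * x `^ a).
    have xs : (x `^ s) ^+ 3 = x * x `^ a.
      rewrite -powR_mulrn ?powR_ge0// -powRrM [s * _]mulrC.
      by rewrite -mulr_powRB1 ?ltW//; lra.
    by rewrite exprMn xs /x; ring.
  have xa : x `^ a <= eta.
    have etaE : eta = (eta `^ a^-1) `^ a.
      by rewrite -powRrM mulVf ?gt_eqF// powRr1// ltW.
    by rewrite [leRHS]etaE; apply: ge0_ler_powR; rewrite ?nnegrE ?powR_ge0// ltW.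
  have NN : 0 <= N ^+ 3 * r ^+ n.
    by apply: mulr_ge0; [exact: exprn_ge0|exact: ltW].
  move=> h; have : c ^+ 3 <= N ^+ 3 * r ^+ n * (c ^+ 3 / 9).
    apply: le_trans h _; rewrite ler_wpM2l//.
    rewrite (_ : c ^+ 3 / 9 = E * eta); last by rewrite /eta; field; rewrite gt_eqF.
    by rewrite ler_pM2l.
  rewrite mulrCA -[leLHS]mulr1 ler_pM2l ?exprn_gt0// ler_pdivlMr//.
  lra.
have small : 27 * (r ^+ n) ^+ 2 <= 1.
  have := rn1; rewrite -(ltr_pM2l (ltr0n _ 27)) mulfV// => h.
  have : r ^+ n <= 1 by lra.
  by rewrite expr2; nra.
have [ds [uds dsK dsep M3 M2]] :=
  homogeneous_subsystem r01 psiE KE Kx0 sz uW sep small big.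
have rho01 : 0 < (r ^+ n) ^+ 2 < 1.
  by rewrite exprn_gt0//=; nra.
have rho0 : 0 < (r ^+ n) ^+ 2 by case/andP: rho01.
(* The pieces of the subsystem are separated by the ratio [(r ^+ n) ^+ 2] itself, which therefore
   also serves as [c0]. *)
have := @ae_circle_sum R K ds _ x0 _ D cK Kx0 KD uds rho01 rho0 dsK dsep M3 M2.
apply: negligibleS => theta /= h; split.
  by apply: contrapT => th; apply: h.
by move=> pos; apply: h.
Qed.
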